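(* Let $n\ge1$, $1<p<\infty$, $A>0$, and $$\Theta:=\{(x,t)\in\mathbb{R}^n\times\mathbb{R}: |x|^2<A|t|\log\bigl|\log|t|\bigr| \text{ and } -\tfrac13<t<0\}.$$ Then $\xi_0=(0,0)$ is regular with respect to $\Theta$ for the normalized $p$-parabolic equation $u_t=\Delta_p^Nu$ if and only if $A\le4(p-1)$.
   Context: Points of $\mathbb{R}^{n+1}$ are written $(x,t)$, $x\in\mathbb{R}^n$, $t\in\mathbb{R}$; $\nabla$, $D^2$, $\Delta$ are taken in $x$ only. For $\nabla u\ne0$, $\Delta_p^N u=\Delta u+(p-2)|\nabla u|^{-2}\langle D^2u\,\nabla u,\nabla u\rangle$. Viscosity supersolution: for $\Theta$ open, $u:\Theta\to(-\infty,\infty]$ is a viscosity supersolution of $u_t=\Delta_p^N u$ in $\Theta$ if (i) $u$ is lower semicontinuous; (ii) $u$ is finite in a dense subset of $\Theta$; (iii) whenever $(x_0,t_0)\in\Theta$ and $\varphi\in C^2(\Theta)$ satisfy $u(x_0,t_0)=\varphi(x_0,t_0)$ and $u>\varphi$ in $\Theta\setminus\{(x_0,t_0)\}$, then at $(x_0,t_0)$: $\varphi_t-\Delta_p^N\varphi\ge0$ if $\nabla\varphi\ne0$, and $\varphi_t-\Delta\varphi-(p-2)\lambda_{\rm eig}\ge0$ if $\nabla\varphi=0$, where $\lambda_{\rm eig}$ is the smallest (if $p\ge2$) or largest (if $p<2$) eigenvalue of $D^2\varphi(x_0,t_0)$. A function $u$ is a viscosity subsolution if $-u$ is a viscosity supersolution,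 and a viscosity solution if it is both. Superparabolic: a space-time box is $Q_{t_1,t_2}=Q\times(t_1,t_2)$ with $Q=(a_1,b_1)\times\dots\times(a_n,b_n)$; its parabolic boundary is $\partial_pQ_{t_1,t_2}=(Q\times\{t_1\})\cup(\partial Q\times[t_1,t_2])$. A function $u:\Theta\to(-\infty,\infty]$ is superparabolic in $\Theta$ if it is lower semicontinuous, finite in a dense subset of $\Theta$, and for each space-time box $Q_{t_1,t_2}$ with compact closure in $\Theta$ and each $h\in C(\overline{Q_{t_1,t_2}})$ that is a viscosity solution in $Q_{t_1,t_2}$ with $h\le u$ on $\partial_pQ_{t_1,t_2}$, one has $h\le u$ in $Q_{t_1,t_2}$. Perron solution: for bounded open $\Theta$ and bounded $f:\partial\Theta\to\mathbb{R}$, $\overline{P}f(\xi)=\inf u(\xi)$, $\xi\in\Theta$, the infimum over all superparabolic $u$ in $\Theta$ with $\liminf_{\Theta\ni\eta\to\zeta}u(\eta)\ge f(\zeta)$ for all $\zeta\in\partial\Theta$. Regularity: $\xi_0\in\partial\Theta$ is regular with respect to $\Theta$ if $\lim_{\Theta\ni\xi\to\xi_0}\overline{P}f(\xi)=f(\xi_0)$ for every $f\in C(\partial\Theta)$. *)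

(* Defs.v *)
From mathcomp Require Import all_boot all_order all_algebra.
From mathcomp Require Import all_classical all_reals all_analysis.

Set Implicit Arguments.
Unset Strict Implicit.
Unset Printing Implicit Defensive.

Import Order.TTheory GRing.Theory Num.Theory.
Import numFieldNormedType.Exports.

Local Open Scope classical_set_scope.
Local Open Scope ring_scope.

(* Functions on a subset of space-time are represented by total functions;
   every notion below only looks at the values on the set in question. *)

Definition boundary (T : topologicalType) (S : set T) : set T :=
  closure S `\` interior S.

Section space_time.
Variables (R : realType) (n : nat).

Definition spacetime : normedModType R := ('rV[R]_n * R)%type.

Implicit Types (xi zeta : spacetime) (phi h f : spacetime -> R)
  (u : spacetime -> \bar R) (Theta : set spacetime) (p : R).

(* The library norm on 'rV[R]_n is the sup norm, hence this definition. *)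
Definition sqnorm (x : 'rV[R]_n) : R := \sum_i x 0 i ^+ 2.

(* [Some i] is the i-th space direction, [None] the time direction. *)
Definition direction (i : option 'I_n) : spacetime :=
  if i is Some j then (delta_mx 0 j, 0) else (0, 1).

Definition partial (i : option 'I_n) phi : spacetime -> R :=
  'D_(direction i) phi.

Definition C2 Theta phi : Prop :=
  forall (i j : option 'I_n) xi, Theta xi ->
    [/\ {for xi, continuous phi},
        derivable phi xi (direction i),
        {for xi, continuous (partial i phi)},
        derivable (partial i phi) xi (direction j)
      & {for xi, continuous (partial j (partial i phi))}].

Definition gradient phi xi : 'rV[R]_n := \row_i partial (Some i) phi xi.

Definition hessian phi xi : 'M[R]_n :=
  \matrix_(i, j) partial (Some j) (partial (Some i) phi) xi.

Definition laplacian phi xi : R := \tr (hessian phi xi).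

Definition normalized_p_laplacian p phi xi : R :=
  let g := gradient phi xi in
  laplacian phi xi
  + (p - 2) * (sqnorm g)^-1 * (g *m hessian phi xi *m g^T) 0 0.

(* For a symmetric matrix of positive size the set of eigenvalues is finite
   and nonempty, so [inf] and [sup] are its minimum and maximum. *)
Definition extremal_eigenvalue p (H : 'M[R]_n) : R :=
  if 2 <= p then inf [set a | eigenvalue H a]
  else sup [set a | eigenvalue H a].

Definition finite_on_dense_subset Theta u : Prop :=
  Theta `<=` closure [set xi | Theta xi /\ u xi \is a fin_num].

Definition viscosity_supersolution p Theta u : Prop :=
  [/\ forall xi, Theta xi -> (-oo < u xi)%E,
      lower_semicontinuous (u : subspace Theta -> \bar R),
      finite_on_dense_subset Theta u
    & forall xi0 phi, Theta xi0 -> C2 Theta phi ->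
        u xi0 = (phi xi0)%:E ->
        (forall xi, Theta xi -> xi != xi0 -> ((phi xi)%:E < u xi)%E) ->
        (gradient phi xi0 != 0 ->
          0 <= partial None phi xi0 - normalized_p_laplacian p phi xi0) /\
        (gradient phi xi0 = 0 ->
          0 <= partial None phi xi0 - laplacian phi xi0
               - (p - 2) * extremal_eigenvalue p (hessian phi xi0))].

Definition viscosity_subsolution p Theta u : Prop :=
  viscosity_supersolution p Theta (fun xi => - u xi)%E.

Definition viscosity_solution p Theta u : Prop :=
  viscosity_supersolution p Theta u /\ viscosity_subsolution p Theta u.

Definition box (a b : 'rV[R]_n) : set 'rV[R]_n :=
  [set x | forall i, a 0 i < x 0 i < b 0 i].

Definition spacetime_box (a b : 'rV[R]_n) (t1 t2 : R) : set spacetime :=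
  box a b `*` [set t | t1 < t < t2].

Definition parabolic_boundary (a b : 'rV[R]_n) (t1 t2 : R) : set spacetime :=
  (box a b `*` [set t1]) `|`
  (boundary (box a b) `*` [set t | t1 <= t <= t2]).

Definition superparabolic p Theta u : Prop :=
  [/\ forall xi, Theta xi -> (-oo < u xi)%E,
      lower_semicontinuous (u : subspace Theta -> \bar R),
      finite_on_dense_subset Theta u
    & forall (a b : 'rV[R]_n) (t1 t2 : R),
        (forall i, a 0 i < b 0 i) -> t1 < t2 ->
        let Q := spacetime_box a b t1 t2 in
        compact (closure Q) -> closure Q `<=` Theta ->
        forall h, {within closure Q, continuous h} ->
          viscosity_solution p Q (EFin \o h) ->
          (forall xi, parabolic_boundary a b t1 t2 xi ->
             ((h xi)%:E <= u xi)%E) ->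
          forall xi, Q xi -> ((h xi)%:E <= u xi)%E].

(* As [Theta] is open, a boundary point is not in [Theta], so the [within]
   filter below is the punctured one. *)
Definition upper_perron p Theta f xi : \bar R :=
  ereal_inf [set u xi | u in
    [set u | superparabolic p Theta u /\
       forall zeta, boundary Theta zeta ->
         ((f zeta)%:E <= limf_einf u (within Theta (nbhs zeta)))%E]].

(* No boundedness of [f] is required: [Theta] is meant to be a bounded open
   set, whose boundary is compact. *)
Definition regular_point p Theta xi0 : Prop :=
  boundary Theta xi0 /\
  forall f, {within boundary Theta, continuous f} ->
    upper_perron p Theta f xi @[xi --> within Theta (nbhs xi0)]
      --> (f xi0)%:E.

Definition petrovsky_domain (A : R) : set spacetime :=
  [set xi | sqnorm xi.1 < A * `|xi.2| * ln `|ln `|xi.2| | /\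
            - (1 / 3) < xi.2 < 0].

End space_time.

Arguments petrovsky_domain {R} n A _.

(* Main.v *)
Require Import Defs.
From mathcomp Require Import all_boot all_order all_algebra.
From mathcomp Require Import all_classical all_reals all_analysis.
From mathcomp Require Import ring lra spectral complex sesquilinear.

Set Implicit Arguments.
Unset Strict Implicit.
Unset Printing Implicit Defensive.

Import Order.TTheory GRing.Theory Num.Theory.
Import numFieldNormedType.Exports.
Local Open Scope classical_set_scope.
Local Open Scope ring_scope.

(* On functions of r = |x - y| and t the normalized p-Laplacian is the linear
   operator (p - 1) d_rr + (n - 1)/r d_r, and a smooth radial solution of the
   resulting linear equation, critical only at its centre, is a viscosity
   solution.

   Superparabolic functions can be compared with a smooth radial classical
   subsolution v without solving a Dirichlet problem. At a minimum of
   (T - t)(u - v) one has a touching from below by the strict subsolution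
   v - M/(T - t). There an explicit radial caloric polynomial, about another
   centre on the line through 0 and the touching point, has the same gradient, a
   smaller Hessian and a larger time derivative; on the parabolic boundary of a
   small box it lies below u with a gap, which contradicts the definition of
   superparabolicity. In the other direction, a smooth radial classical
   supersolution is superparabolic by direct comparison with the test function.

   With s = -t, tau = log(1/s) and E = exp(kappa |x|^2 / s), all barriers have
   the form g0 + g1 tau^(-c) + theta tau^(-m) E. If A <= 4(p - 1), then with
   kappa = 1/(4(p - 1)), c = (n + p - 2) kappa and m = 1 + c the function
   tau^(-c) - tau^(-m) E / 2 is a positive supersolution vanishing exactly at the
   origin. If A > 4(p - 1), choose 1/A < kappa < 1/(4(p - 1)) and
   m = kappa A > 1; then 1 + C tau^(1-m) - tau^(-m) E is a subsolution that is at
   least 1 on the axis and at most C tau^(1-m), which tends to 0, on the lateral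
   boundary. *)

(** * Jets along coordinate directions *)

Section Jets.
Context {R : realType}.

(** Restriction to a line turns directional derivatives into one-variable ones, to which the chain
    rule and the mean value theorem on [R] apply. *)
Lemma is_derive_lineP (V : normedModType R) (f : V -> R) (x v : V) (d : R) :
  is_derive x v f d <-> is_derive (0 : R) 1 (fun h => f (h *: v + x)) d.
Proof.
have E : 'D_v f x = 'D_1 (fun h : R => f (h *: v + x)) 0.
  rewrite /derive; set F := (X in X @ _); set G := (X in _ = lim (X @ _)).
  suff -> : F = G by [].
  apply/funext => h; rewrite /F /G /=.
  by rewrite addr0 [h *: 1]mulr1 scale0r add0r.
have D := derivable1P f x v.
split=> -[dv ev].
  by apply: DeriveDef; [exact: D.1|rewrite -E].
by apply: DeriveDef; [exact: D.2|rewrite E].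
Qed.

Lemma is_derive_line_at (V : normedModType R) (f : V -> R) (x v : V) (d s : R) :
  is_derive (s *: v + x) v f d <-> is_derive s 1 (fun h => f (h *: v + x)) d.
Proof.
rewrite is_derive_lineP [X in _ <-> X]is_derive_lineP.
suff -> : (fun h => f (h *: v + (s *: v + x))) = (fun h : R => f ((h *: 1 + s) *: v +
  x)) by [].
by apply/funext => h; rewrite scalerDl addrA [h *: 1]mulr1.
Qed.

Lemma is_derive_comp1 (V : normedModType R) (f : R -> R) (g : V -> R) (x v : V) (a b :
  R) :
  is_derive (g x) 1 f a -> is_derive x v g b -> is_derive x v (f \o g) (a * b).
Proof.
move=> df /is_derive_lineP dg; apply/is_derive_lineP.
apply: (@is_derive1_comp R f (fun h => g (h *: v + x)) 0 a b) => //.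
by rewrite scale0r add0r.
Qed.

Variable n : nat.
Local Notation S := (spacetime R n).
Local Notation direction := (@direction R n).
Implicit Types (phi psi : S -> R) (xi : S) (O : set S).

(** Derivatives are carried as explicit functions, so that those of composite expressions are
    computed by algebra. [PP i j] differentiates along [i] first and then along [j]; symmetry is not
    built in. *)
Definition jet2 O phi (P : option 'I_n -> S -> R)
    (PP : option 'I_n -> option 'I_n -> S -> R) : Prop :=
  forall xi, O xi ->
  [/\ {for xi, continuous phi},
      forall i, is_derive xi (direction i) phi (P i xi),
      forall i, {for xi, continuous (P i)},
      forall i j, is_derive xi (direction j) (P i) (PP i j xi)
    & forall i j, {for xi, continuous (PP i j)}].

Lemma jet2_subset O O' phi P PP : O `<=` O' -> jet2 O' phi P PP -> jet2 O phi P PP.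
Proof. by move=> sO h xi /sO/h. Qed.

Lemma jet2_cst O (c : R) : jet2 O (fun=> c) (fun _ _ => 0) (fun _ _ _ => 0).
Proof.
by move=> xi _; split => *; try exact: is_derive_cst; exact: cvg_cst.
Qed.

Lemma jet2D O phi P PP psi Q QQ : jet2 O phi P PP -> jet2 O psi Q QQ ->
  jet2 O (fun xi => phi xi + psi xi) (fun i xi => P i xi + Q i xi)
    (fun i j xi => PP i j xi + QQ i j xi).
Proof.
move=> h1 h2 xi Oxi.
have [c1 d1 c1' d1' c1''] := h1 xi Oxi; have [c2 d2 c2' d2' c2''] := h2 xi Oxi.
by split => *; first [apply: is_deriveD|apply: continuousD].
Qed.

Lemma jet2M O phi P PP psi Q QQ : jet2 O phi P PP -> jet2 O psi Q QQ ->
  jet2 O (fun xi => phi xi * psi xi) (fun i xi => phi xi * Q i xi + psi xi * P i xi)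
    (fun i j xi => (phi xi * QQ i j xi + Q i xi * P j xi)
                 + (psi xi * PP i j xi + P i xi * Q j xi)).
Proof.
move=> h1 h2 xi Oxi.
have [c1 d1 c1' d1' c1''] := h1 xi Oxi; have [c2 d2 c2' d2' c2''] := h2 xi Oxi.
split => *.
- exact: continuousM.
- exact: is_deriveM.
- by apply: continuousD; apply: continuousM.
- by apply: is_deriveD; apply: is_deriveM.
- by apply: continuousD; apply: continuousD; apply: continuousM.
Qed.

Lemma jet2_comp O phi P PP (f f1 f2 : R -> R) : jet2 O phi P PP ->
  (forall xi, O xi -> [/\ is_derive (phi xi) 1 f (f1 (phi xi)),
     is_derive (phi xi) 1 f1 (f2 (phi xi)) & {for phi xi, continuous f2}]) ->
  jet2 O (fun xi => f (phi xi)) (fun i xi => f1 (phi xi) * P i xi)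
    (fun i j xi => f1 (phi xi) * PP i j xi + P i xi * (f2 (phi xi) * P j xi)).
Proof.
move=> h1 h2 xi Oxi.
have [c1 d1 c1' d1' c1''] := h1 xi Oxi; have [e1 e2 c2] := h2 xi Oxi.
have d2c (g : R -> R) (x d : R) : is_derive x 1 g d -> {for x, continuous g}.
  by move=> [dg _]; apply: differentiable_continuous; apply/derivable1_diffP.
have cf := d2c _ _ _ e1; have cf1 := d2c _ _ _ e2.
have kf : {for xi, continuous (fun xi => f (phi xi))} by exact: (@continuous_comp _ _ _
  phi f).
have kf1 : {for xi, continuous (fun xi => f1 (phi xi))} by exact: (@continuous_comp _ _
  _ phi f1).
have kf2 : {for xi, continuous (fun xi => f2 (phi xi))} by exact: (@continuous_comp _ _
  _ phi f2).
split => // *.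
- exact: is_derive_comp1.
- exact: continuousM.
- apply: is_deriveM => //; exact: is_derive_comp1.
- by apply: continuousD; apply: continuousM => //; apply: continuousM.
Qed.

Lemma jet2Z O phi P PP (c : R) : jet2 O phi P PP ->
  jet2 O (fun xi => c * phi xi) (fun i xi => c * P i xi) (fun i j xi => c * PP i j xi).
Proof.
move=> h xi Oxi; have [c1 d1 c1' d1' c1''] := h xi Oxi.
have K (f : S -> R) : {for xi, continuous f} -> {for xi, continuous (fun x => c * f x)}.
  by move=> cf; apply: continuousM => //; exact: cvg_cst.
by split => *; first [exact: K|exact: is_deriveZ].
Qed.

Lemma direction_coord (i : option 'I_n) (h : R) xi (j : 'I_n) :
  (h *: direction i + xi : S).1 0 j = h * (i == Some j)%:R + xi.1 0 j.
Proof.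
case: i => [i|] /=; rewrite !mxE ?eqxx /=; last by rewrite !mulr0.
by rewrite (_ : (Some i == Some j) = (j == i)) // eq_sym.
Qed.

Lemma direction_time (i : option 'I_n) (h : R) xi :
  (h *: direction i + xi : S).2 = h * (i == None)%:R + xi.2.
Proof. by case: i. Qed.

Lemma jet2_time O : jet2 O (fun xi => xi.2) (fun i _ => (i == None)%:R) (fun _ _ _ => 0).
Proof.
move=> xi _; split => *; try (by exact: is_derive_cst); try exact: cvg_cst.
- exact: cvg_snd.
- apply/is_derive_lineP; under eq_fun do rewrite direction_time.
  by apply: is_derive_eq; rewrite scaler0 add0r addr0 [_%:A]mulr1.
Qed.

Lemma continuous_space xi (j : 'I_n) : {for xi, continuous (fun xi : S => xi.1 0 j)}.
Proof.
apply: (@continuous_comp _ _ _ fst (fun x : 'rV[R]_n => x 0 j)); first exact: cvg_fst.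
exact: coord_continuous.
Qed.

Lemma jet2_space O (j : 'I_n) (c : R) :
  jet2 O (fun xi => xi.1 0 j - c) (fun i _ => (i == Some j)%:R) (fun _ _ _ => 0).
Proof.
move=> xi _; split => *; try (by exact: is_derive_cst); try exact: cvg_cst.
- by apply: continuousD; [exact: continuous_space|exact: cvg_cst].
- apply/is_derive_lineP; under eq_fun do rewrite direction_coord.
  by apply: is_derive_eq; rewrite scaler0 add0r ?oppr0 !addr0 [_%:A]mulr1.
Qed.

Lemma jet2_sqnorm O (y : 'rV[R]_n) :
  jet2 O (fun xi => sqnorm (xi.1 - y))
    (fun i xi => if i is Some i then 2 * (xi.1 0 i - y 0 i) else 0)
    (fun i j _ => 2 * ((i == j) && (i != None))%:R).
Proof.
(* Both orders of derivatives are written as sums over coordinates, the form obtained by adding the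
   jets of the squares. *)
pose P (i : option 'I_n) (xi : S) := \sum_(j < n) 2 * ((xi.1 0 j - y 0 j) * (i == Some
  j)%:R).
have EP : (fun i (xi : S) => if i is Some i then 2 * (xi.1 0 i - y 0 i) else 0) = P.
  apply/funext => -[i|]; apply/funext => xi; rewrite /P.
    rewrite (bigD1 i) //= eqxx mulr1 big1 ?addr0 // => j /negPf ji.
    by rewrite (_ : (_ == _) = (i == j)) // eq_sym ji !mulr0.
  by rewrite big1 // => j _; rewrite !mulr0.
rewrite EP.
pose PP (i i' : option 'I_n) (_ : S) : R := \sum_(j < n) 2 * ((i' == Some j)%:R * (i ==
  Some j)%:R).
have -> : (fun (i j : option 'I_n) (_ : S) => 2 * ((i == j) && (i != None))%:R : R) = PP.
  apply/funext => -[i|]; apply/funext => -[i'|]; apply/funext => xi; rewrite /PP /=.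
  - rewrite (bigD1 i) //= eqxx mulr1 big1 ?addr0; first by rewrite andbT eq_sym.
    move=> j ji; have -> : (Some i == Some j) = false.
      by apply/negbTE; apply: contra ji => /eqP[->].
    by rewrite !mulr0.
  - by rewrite mulr0 big1 // => j _; rewrite mul0r mulr0.
  - by rewrite mulr0 big1 // => j _; rewrite !mulr0.
  - by rewrite mulr0 big1 // => j _; rewrite !mulr0.
have Es : (fun xi : S => sqnorm (xi.1 - y)) = \sum_(j < n) (fun xi : S => (xi.1 0 j - y
  0 j) ^+ 2).
  apply/funext => xi; rewrite fct_sumE /sqnorm; apply: eq_bigr => j _.
  by rewrite !mxE.
have EsP i : P i = \sum_(j < n) (fun xi : S => 2 * ((xi.1 0 j - y 0 j) * (i == Some
  j)%:R)).
  by apply/funext => xi; rewrite fct_sumE.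
have J j : jet2 O (fun xi => (xi.1 0 j - y 0 j) ^+ 2)
   (fun i (xi : S) => 2 * ((xi.1 0 j - y 0 j) * (i == Some j)%:R))
   (fun i i' (_ : S) => 2 * ((i' == Some j)%:R * (i == Some j)%:R)).
  have /= := jet2M (@jet2_space O j (y 0 j)) (@jet2_space O j (y 0 j)).
  move=> h xi /h[h1 h2 h3 h4 h5]; split => [|i|i|i j0|i j0].
  - exact: h1.
  - rewrite mulr_natl mulr2n; exact: h2.
  - rewrite (_ : (fun _ => _) = (fun xi : S => (xi.1 0 j - y 0 j) * (i == Some j)%:R +
    (xi.1 0 j - y 0 j) * (i == Some j)%:R)); first exact: h3.
    by apply/funext => z; rewrite mulr_natl mulr2n.
  - rewrite (_ : (fun _ => _) = (fun xi : S => (xi.1 0 j - y 0 j) * (i == Some j)%:R +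
    (xi.1 0 j - y 0 j) * (i == Some j)%:R)).
      apply: is_derive_eq (h4 i j0) _.
      ring.
    by apply/funext => z; rewrite mulr_natl mulr2n.
  - exact: cvg_cst.
have csum (f : 'I_n -> S -> R) xi : (forall j, {for xi, continuous (f j)}) ->
    {for xi, continuous (\sum_(j < n) f j)}.
  by move=> cf; apply: (big_ind (fun g => {for xi, continuous g})) => //;
    [exact: cvg_cst|move=> g1 g2; exact: continuousD].
move=> xi Oxi; split => [|i|i|i i'|i i'].
- by rewrite Es; apply: csum => j; have [] := J j _ Oxi.
- by rewrite Es; apply: is_derive_sum => j; have [] := J j _ Oxi.
- by rewrite EsP; apply: csum => j; have [] := J j _ Oxi.
- by rewrite EsP; apply: is_derive_sum => j; have [] := J j _ Oxi.
- exact: cvg_cst.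
Qed.

Lemma jet2_C2 O phi P PP : open O -> jet2 O phi P PP ->
  [/\ C2 O phi, forall i xi, O xi -> partial i phi xi = P i xi
   & forall i j xi, O xi -> partial j (partial i phi) xi = PP i j xi].
Proof.
move=> oO J.
have E1 i xi : O xi -> partial i phi xi = P i xi.
  by move=> /J[_ d _ _ _]; rewrite /partial; have [_] := d i.
(* [partial i phi] is known to equal [P i] only on [O]; as [O] is open, they agree near each of its
   points, which suffices to differentiate once more. *)
have near1 i xi : O xi -> \near xi, P i xi = partial i phi xi.
  by move=> Oxi; near=> z; rewrite E1 //; near: z; exact: open_nbhs_nbhs.
have D2 i j xi : O xi -> is_derive xi (direction j) (partial i phi) (PP i j xi).
  move=> Oxi; have [_ _ _ d _] := J _ Oxi.
  exact: near_eq_is_derive (near1 i xi Oxi) (d i j).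
have E2 i j xi : O xi -> partial j (partial i phi) xi = PP i j xi.
  by move=> Oxi; rewrite /partial; have [_] := D2 i j xi Oxi.
have near2 i j xi : O xi -> \near xi, PP i j xi = partial j (partial i phi) xi.
  by move=> Oxi; near=> z; rewrite E2 //; near: z; exact: open_nbhs_nbhs.
have cN (f g : S -> R) xi : f xi = g xi -> (\near xi, f xi = g xi) -> {for xi,
  continuous f} -> {for xi, continuous g}.
  by move=> e nfg cf; rewrite /prop_for /continuous_at -e; apply: cvg_trans cf; apply:
    near_eq_cvg.
split => // i j xi Oxi; have [c d c' d' c''] := J _ Oxi.
split; [exact: c|by case: (d i)| |by case: (D2 i j xi Oxi)|].
  by apply: cN (near1 i xi Oxi) (c' i); rewrite E1.
by apply: cN (near2 i j xi Oxi) (c'' i j); rewrite E2.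
Unshelve. all: by end_near.
Qed.

Lemma C2_jet2 O phi : C2 O phi ->
  jet2 O phi (fun i => partial i phi) (fun i j => partial j (partial i phi)).
Proof.
move=> h xi Oxi; split => [|i|i|i j|i j].
- by have [] := h None None xi Oxi.
- by have [_ d _ _ _] := h i i xi Oxi; apply: derivableP.
- by have [] := h i i xi Oxi.
- by have [_ _ _ d _] := h i j xi Oxi; apply: derivableP.
- by have [] := h i j xi Oxi.
Qed.

End Jets.

(** * Derivatives along lines *)

Section LineDerivatives.
Context {R : realType} {V : normedModType R}.
Implicit Types (psi : V -> R) (x a e : V).

Lemma is_derive_scale_dir psi x e (d k : R) :
  is_derive x e psi d -> is_derive x (k *: e) psi (k * d).
Proof.
move=> /is_derive_lineP dl; apply/is_derive_lineP.
have -> : (fun h => psi (h *: (k *: e) + x)) = (fun h : R => psi (h *: e + x)) \o (fun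
  h => h * k).
  by apply/funext => h /=; rewrite scalerA.
rewrite mulrC; apply: is_derive1_comp; first by rewrite mul0r.
by apply: is_derive_eq; rewrite scaler0 add0r [_%:A]mulr1.
Qed.

Lemma MVT_line psi x e (Pe : V -> R) :
  (forall s : R, 0 <= s <= 1 -> is_derive (s *: e + x) e psi (Pe (s *: e + x))) ->
  exists2 s : R, 0 < s < 1 & psi (e + x) - psi x = Pe (s *: e + x).
Proof.
move=> d.
have dg (s : R) : s \in `[0, 1] -> is_derive s 1 (fun h : R => psi (h *: e + x)) (Pe (s
  *: e + x)).
  by rewrite in_itv /= => /d ds; exact: (is_derive_line_at psi x e _ s).1.
pose g (h : R) := psi (h *: e + x).
have cg : {within `[0, 1], continuous g}.
  by apply: derivable_within_continuous => s /dg [ds _].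
have dg' (s : R) : s \in `]0, 1[ -> is_derive s 1 g (Pe (s *: e + x)).
  by move=> s01; exact: dg (subset_itv_oo_cc s01).
have [s] := @MVT R g (fun s => Pe (s *: e + x)) 0 1 ltr01 dg' cg.
rewrite in_itv /= => s01; rewrite /g scale1r scale0r add0r subr0 mulr1 => E.
by exists s.
Qed.

(** The increment along [h *: (c *: e)] starts from [h *: a + x]; the mean value theorem expresses
    it through a value of [Pe] near [x], where [Pe] is continuous. Along [a] a derivative at [x]
    alone is used, so directions can be added one at a time. *)
Lemma is_derive_add_dir psi x a e (Pe : V -> R) (d c : R) :
  (\near x, is_derive x e psi (Pe x)) -> {for x, continuous Pe} ->
  is_derive x a psi d -> is_derive x (a + c *: e) psi (d + c * Pe x).
Proof.
move=> nd cPe [da ea].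
suff C : h^-1 *: (psi (h *: (a + c *: e) + x) - psi x) @[h --> (0:R)^'] --> d + c * Pe x.
  apply: DeriveDef; first by apply/cvg_ex; exists (d + c * Pe x).
  exact: cvg_lim.
have E : \forall h \near (0:R)^', h^-1 *: (psi (h *: a + x) - psi x) +
   h^-1 *: (psi (h *: (a + c *: e) + x) - psi (h *: a + x)) =
   h^-1 *: (psi (h *: (a + c *: e) + x) - psi x).
  by near=> h; rewrite -scalerDr; congr (_ *: _); ring.
apply: cvg_trans; first exact: near_eq_cvg E.
apply: cvgD; first by rewrite -ea; exact: da.
apply/cvgrPdist_le => eps eps0.
have c1 : 0 < `|c| + 1 by rewrite ltr_wpDl.
have /nbhs_normP[r /= r0 Hr] : \forall z \near x,
    is_derive z e psi (Pe z) /\ `|Pe x - Pe z| <= eps / (`|c| + 1).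
  apply: filterI => //; have /cvgrPdist_le := cPe; apply; exact: divr_gt0.
have M0 : 0 < `|a| + `|c| * `|e| + 1 by rewrite ltr_wpDl // addr_ge0 // mulr_ge0.
(* So small an [h] keeps the whole segment travelled along [e] inside the ball of radius [r]. *)
have : \forall h \near (0:R)^', `|h| < r / (`|a| + `|c| * `|e| + 1).
  by apply: dnbhs0_lt; rewrite divr_gt0.
have : \forall h \near (0:R)^', h != 0 by exact: nbhs_dnbhs_neq.
apply: filterS2 => h h0; rewrite ltr_pdivlMr // => hr.
have inb (s : R) : 0 <= s <= 1 -> `|x - (s *: (h *: (c *: e)) + (h *: a + x))| < r.
  move=> /andP[s0 s1]; apply: le_lt_trans hr.
  rewrite opprD addrC -addrA opprD addrNK -opprD normrN.
  apply: le_trans (ler_normD _ _) _; rewrite !normrZ.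
  rewrite mulrDr mulrDr mulr1 (ger0_norm s0).
  have hce : 0 <= `|h| * (`|c| * `|e|) by rewrite !mulr_ge0.
  have : s * (`|h| * (`|c| * `|e|)) <= `|h| * (`|c| * `|e|) by rewrite ler_piMl.
  by have := normr_ge0 h; lra.
have [s Hs|s s01] := @MVT_line psi (h *: a + x) (h *: (c *: e)) (fun z => h * (c * Pe z)).
  have [dz _] := Hr _ (inb s Hs).
  by do 2!apply: is_derive_scale_dir.
rewrite addrA -scalerDr addrC [c *: e + a]addrC addrC => ->.
have s01' : 0 <= s <= 1 by case/andP: s01 => /ltW -> /ltW ->.
have [_ Hz] := Hr _ (inb s s01').
rewrite [_ *: _]mulrA mulVf // mul1r -mulrBr normrM.
apply: le_trans (ler_wpM2l (normr_ge0 c) Hz) _.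
by rewrite mulrA ler_pdivrMr // mulrDr mulr1 [`|c| * eps]mulrC lerDl ltW.
Unshelve. all: by end_near.
Qed.

(** Two mean value theorems: one along [e] for the increment of [psi] by [h *: f], then one along
    [f] for [Pe]. *)
Lemma second_difference psi x e f (Pe Pef : V -> R) (r h : R) :
  (forall z, `|x - z| < r -> is_derive z e psi (Pe z)) ->
  (forall z, `|x - z| < r -> is_derive z f Pe (Pef z)) ->
  0 < h -> h * (`|e| + `|f|) < r ->
  exists2 z, `|x - z| <= h * (`|e| + `|f|) &
    psi (h *: e + (h *: f + x)) - psi (h *: e + x) - psi (h *: f + x) + psi x
      = h * (h * Pef z).
Proof.
move=> d1 d2 h0 hr.
have inb (s s' : R) : 0 <= s <= 1 -> 0 <= s' <= 1 ->
    `|x - (s' *: (h *: f) + (s *: (h *: e) + x))| <= h * (`|e| + `|f|).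
  move=> /andP[s0 s1] /andP[s0' s1'].
  rewrite addrA opprD [x + _]addrC addrNK normrN.
  apply: le_trans (ler_normD _ _) _; rewrite !normrZ (gtr0_norm h0) (ger0_norm s0)
    (ger0_norm s0').
  rewrite mulrDr addrC; apply: lerD; rewrite ler_piMl // mulr_ge0 // ltW //.
have z01 : 0 <= (0:R) <= 1 by rewrite lexx ler01.
have o01 : 0 <= (1:R) <= 1 by rewrite lexx ler01.
have [s Hs|s s01] := @MVT_line (fun z => psi (h *: f + z) - psi z) x (h *: e)
   (fun z => h * Pe (h *: f + z) - h * Pe z).
  apply: is_deriveB; apply: is_derive_scale_dir.
    have := d1 _ (le_lt_trans (inb s 1 Hs o01) hr).
    move=> /is_derive_lineP dd; apply/is_derive_lineP.
    rewrite scale1r in dd; apply: is_derive_eq (_ : is_derive _ _ _ (Pe (h *: f + (s *: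
      (h *: e) + x)))) _ => //.
    rewrite (_ : (fun _ => _) = (fun h0 : R => psi (h0 *: e + (h *: f + (s *: (h *: e)
      + x))))) //.
    by apply/funext => k; rewrite !addrA [k *: e + _]addrC.
  have := d1 _ (le_lt_trans (inb s 0 Hs z01) hr).
  by rewrite scale0r add0r.
move=> E.
have s01' : 0 <= s <= 1 by case/andP: s01 => /ltW -> /ltW ->.
have [s' Hs'|s' s01''] := @MVT_line Pe (s *: (h *: e) + x) (h *: f) (fun z => h * Pef z).
  by apply: is_derive_scale_dir; apply: d2; exact: le_lt_trans (inb _ _ s01' Hs') hr.
move=> E'; exists (s' *: (h *: f) + (s *: (h *: e) + x)).
  by apply: inb => //; case/andP: s01'' => /ltW -> /ltW ->.
rewrite -E' mulrBr -E [h *: f + (h *: e + x)]addrCA; ring.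
Qed.

(** Schwarz's theorem: the second difference is symmetric in [e] and [f], so the two mixed
    derivatives coincide at suitable points close to [x], and continuity carries this to [x]. *)
Lemma mixed_derivatives_eq psi x e f (Pe Pf Pef Pfe : V -> R) :
  (\near x, is_derive x e psi (Pe x)) -> (\near x, is_derive x f psi (Pf x)) ->
  (\near x, is_derive x f Pe (Pef x)) -> (\near x, is_derive x e Pf (Pfe x)) ->
  {for x, continuous Pef} -> {for x, continuous Pfe} -> Pef x = Pfe x.
Proof.
move=> n1 n2 n3 n4 c1 c2.
suff : forall eps, 0 < eps -> `|Pef x - Pfe x| <= eps.
  by move=> H; apply/eqP; rewrite -subr_eq0 -normr_le0; apply/ler_addgt0Pr => z z0;
    rewrite add0r; exact: H.
move=> eps eps0; have eps2 : 0 < eps / 2 by rewrite divr_gt0.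
have /cvgrPdist_le/(_ _ eps2) k1 := c1.
have /cvgrPdist_le/(_ _ eps2) k2 := c2.
have /nbhs_normP[r /= r0 Hr] : \forall z \near x,
   (is_derive z e psi (Pe z) /\ is_derive z f psi (Pf z)) /\
   (is_derive z f Pe (Pef z) /\ is_derive z e Pf (Pfe z)) /\
   (`|Pef x - Pef z| <= eps / 2 /\ `|Pfe x - Pfe z| <= eps / 2).
  by apply: filterI; [|apply: filterI]; exact: filterI.
pose M := `|e| + `|f| + 1.
have M0 : 0 < M by rewrite ltr_wpDl // addr_ge0.
pose h := r / 2 / M.
have h0 : 0 < h by rewrite !divr_gt0.
have hr : h * (`|e| + `|f|) < r.
  have : h * M = r / 2 by rewrite /h divfK // gt_eqF.
  by rewrite /M mulrDr mulr1; lra.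
have [z zb Ez] : exists2 z, `|x - z| <= h * (`|e| + `|f|) &
    psi (h *: e + (h *: f + x)) - psi (h *: e + x) - psi (h *: f + x) + psi x = h * (h
      * Pef z).
  by apply: (@second_difference psi x e f Pe Pef r h) => // z /Hr[[? ?] [[? ?] _]].
have [w wb Ew] : exists2 w, `|x - w| <= h * (`|f| + `|e|) &
    psi (h *: f + (h *: e + x)) - psi (h *: f + x) - psi (h *: e + x) + psi x = h * (h
      * Pfe w).
  apply: (@second_difference psi x f e Pf Pfe r h) => //; last by rewrite [_ + `|e|]addrC.
    by move=> w /Hr[[? ?] [[? ?] _]].
  by move=> w /Hr[[? ?] [[? ?] _]].
have Ezw : Pef z = Pfe w.
  have hh : h * h != 0 by rewrite mulf_neq0 // gt_eqF.
  apply: (mulfI hh); rewrite -[LHS]mulrA -[RHS]mulrA -Ez -Ew [h *: f + (h *: e +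
    x)]addrCA; ring.
have [_ [_ [H1 _]]] := Hr _ (le_lt_trans zb hr).
rewrite [_ + `|e|]addrC in wb.
have [_ [_ [_ H2]]] := Hr _ (le_lt_trans wb hr).
rewrite (_ : Pef x - Pfe x = (Pef x - Pef z) - (Pfe x - Pfe w)); last by rewrite Ezw;
  ring.
apply: le_trans (ler_normB _ _) _; lra.
Qed.

End LineDerivatives.

(** If [L] were positive, [g1] would be positive just to the right of 0, and [g] would exceed [g 0]
    there by the mean value theorem. *)
Lemma second_derivative_at_max {R : realType} (g g1 : R -> R) (L r : R) :
  0 < r -> (forall s : R, `|s| < r -> is_derive s 1 g (g1 s)) ->
  is_derive (0 : R) 1 g1 L ->
  (forall s : R, `|s| < r -> g s <= g 0) -> g1 0 = 0 /\ L <= 0.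
Proof.
move=> r0 H1 dL H2.
have Hr' (s : R) : `|s| < r -> is_derive s 1 g (g1 s) /\ g s <= g 0.
  by move=> sr; split; [exact: H1|exact: H2].
have g10 : g1 0 = 0.
  have r2 : - r <= r by lra.
  have inr (t : R) : t \in `](- r), r[ -> `|t| < r by rewrite in_itv /= ltr_norml.
  have dg (t : R) : t \in `](- r), r[ -> derivable g t 1 by move=> /inr/H1 [].
  have c0 : (0 : R) \in `](- r), r[ by rewrite in_itv /= oppr_lt0 r0.
  have gmax (t : R) : t \in `](- r), r[ -> g t <= g 0 by move=> /inr/H2.
  have [_ E0] := derive1_at_max r2 dg c0 gmax.
  have /H1[_ E1] : `|0 : R| < r by rewrite normr0.
  by rewrite -E1 E0.
split=> //; rewrite leNgt; apply/negP => L0.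
have [/cvg_ex[/= l cl] E] := dL.
have /cvgrPdist_lt/(_ _ L0) : h^-1 *: (g1 (h *: 1 + 0) - g1 0) @[h --> (0:R)^'] --> L.
  by rewrite -E; apply: cvgP; exact: cl.
move=> /nbhs_normP[r' /= r'0 Hr'2].
pose m := Num.min r r' / 2.
have m0 : 0 < m by rewrite divr_gt0 // lt_min r0.
have mr : m < r by rewrite /m ltr_pdivrMr // gt_min; apply/orP; left; lra.
have mr' : m < r' by rewrite /m ltr_pdivrMr // gt_min; apply/orP; right; lra.
have [s /andP[s0 s1]] : exists2 s : R, 0 < s < 1 & g (m + 0) - g 0 = m * g1 (s *: m + 0).
  apply: (@MVT_line R R g 0 m (fun z => m * g1 z)) => s /andP[s0 s1].
  rewrite -[m in is_derive _ m]mulr1; apply: is_derive_scale_dir.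
  have smr : `|s * m| < r.
    rewrite ger0_norm; last by rewrite mulr_ge0 // ltW.
    by apply: le_lt_trans mr; rewrite ler_piMl // ltW.
  by rewrite addr0; exact: H1.
rewrite !addr0 [s *: m]/(s * m) => Es.
have sm0 : 0 < s * m by rewrite mulr_gt0.
have smm : s * m < m by rewrite gtr_pMl.
have : 0 < g1 (s * m).
  have := Hr'2 (s * m); rewrite /ball_ /= sub0r normrN gtr0_norm //.
  move=> /(_ (lt_trans smm mr') (lt0r_neq0 sm0)).
  rewrite addr0 [_ *: 1]mulr1 g10 subr0 ltr_distlC => /andP[+ _].
  by rewrite subrr [_ *: _]/(_ * _) pmulr_rgt0 // invr_gt0.
move=> g1p; have := H2 m; rewrite gtr0_norm // => /(_ mr).
rewrite leNgt => /negP; apply; rewrite -subr_gt0 Es; exact: mulr_gt0.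
Qed.

Section SpaceLines.
Context {R : realType} {n : nat}.
Local Notation S := (spacetime R n).
Local Notation direction := (@direction R n).
Implicit Types (phi psi : S -> R) (xi : S) (O : set S) (v : 'rV[R]_n).

Lemma space_direction v : \sum_(j < n) v 0 j *: direction (Some j) = (v, 0) :> S.
Proof.
have E (r : seq 'I_n) : \sum_(j <- r) v 0 j *: direction (Some j) =
    (\sum_(j <- r) v 0 j *: delta_mx 0 j, 0) :> S.
  elim: r => [|j r IH]; rewrite ?big_nil // !big_cons IH.
  by apply: injective_projections; rewrite //= scaler0 addr0.
by rewrite E -row_sum_delta.
Qed.

Lemma is_derive_space psi (Q : 'I_n -> S -> R) O xi v : open O -> O xi ->
  (forall j z, O z -> is_derive z (direction (Some j)) psi (Q j z)) ->
  (forall j, {for xi, continuous (Q j)}) ->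
  is_derive xi (v, 0 : R) psi (\sum_(j < n) v 0 j * Q j xi).
Proof.
move=> oO Oxi dQ cQ; rewrite -space_direction.
elim: (index_enum _) => [|j r IH]; first by rewrite !big_nil; exact: is_derive0.
rewrite !big_cons addrC [X in is_derive _ _ _ X]addrC.
apply: is_derive_add_dir => //; near=> z; apply: dQ; near: z.
exact: open_nbhs_nbhs.
Unshelve. all: by end_near.
Qed.

Lemma jet2_line O phi P PP v xi : open O -> jet2 O phi P PP -> O xi ->
  is_derive xi (v, 0 : R) phi (\sum_(j < n) v 0 j * P (Some j) xi) /\
  is_derive xi (v, 0 : R) (fun z => \sum_(j < n) v 0 j * P (Some j) z)
    (\sum_(i < n) v 0 i * \sum_(j < n) v 0 j * PP (Some i) (Some j) xi).
Proof.
move=> oO J Oxi; split.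
  by apply: (is_derive_space v oO Oxi (Q := fun j => P (Some j))) => [j z /J[]|j] //;
    have [] := J _ Oxi.
have -> : (fun z => \sum_(j < n) v 0 j * P (Some j) z) =
    \sum_(j < n) (fun z => v 0 j * P (Some j) z).
  by apply/funext => z; rewrite fct_sumE.
apply: is_derive_sum => i; apply: is_deriveZ.
by apply: (is_derive_space v oO Oxi (Q := fun j => PP (Some i) (Some j))) => [j z
  /J[]|j] //; have [] := J _ Oxi.
Qed.

Lemma max_along_line O phi xi (e : S) (De : S -> R) (L : R) : open O -> O xi ->
  (forall z, O z -> phi z <= phi xi) ->
  (forall z, O z -> is_derive z e phi (De z)) -> is_derive xi e De L ->
  De xi = 0 /\ L <= 0.
Proof.
move=> oO Oxi m d d2.
have /nbhs_normP[r /= r0 Hr] : nbhs xi O by exact: open_nbhs_nbhs.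
have M0 : 0 < `|e| + 1 by rewrite ltr_wpDl.
have q0 : 0 < r / (`|e| + 1) by rewrite divr_gt0.
have inO (s : R) : `|s| < r / (`|e| + 1) -> O (s *: e + xi).
  rewrite ltr_pdivlMr // => sr; apply: Hr => /=.
  rewrite opprD addrC addrNK normrN normrZ; apply: le_lt_trans sr.
  by rewrite ler_wpM2l // lerDl.
pose g (s : R) := phi (s *: e + xi); pose g1 (s : R) := De (s *: e + xi).
have H1 (s : R) : `|s| < r / (`|e| + 1) -> is_derive s 1 g (g1 s).
  by move=> /inO/d; exact: (is_derive_line_at phi xi e (De (s *: e + xi)) s).1.
have H2 (s : R) : `|s| < r / (`|e| + 1) -> g s <= g 0.
  by move=> /inO/m; rewrite /g scale0r add0r.
have H3 : is_derive (0 : R) 1 g1 L by exact: (is_derive_lineP De xi e L).1.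
have := second_derivative_at_max q0 H1 H3 H2.
by rewrite /g1 scale0r add0r.
Qed.

Lemma jet2_local_max O phi P PP xi : open O -> jet2 O phi P PP -> O xi ->
  (forall z, O z -> phi z <= phi xi) ->
  (forall i, P i xi = 0) /\
  forall v, \sum_(i < n) v 0 i * \sum_(j < n) v 0 j * PP (Some i) (Some j) xi <= 0.
Proof.
move=> oO J Oxi m; split.
  move=> i; have [_ _ _ d _] := J _ Oxi.
  apply: (proj1 (max_along_line oO Oxi m _ (d i i))) => z /J[_ dz _ _ _]; exact: dz.
move=> v; have [_ d] := jet2_line v oO J Oxi.
by apply: (proj2 (max_along_line oO Oxi m _ d)) => z /(jet2_line v oO J)[].
Qed.

Lemma jet2_mixed O phi P PP xi i j : open O -> jet2 O phi P PP -> O xi ->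
  PP i j xi = PP j i xi.
Proof.
move=> oO J Oxi.
have nO : \forall z \near xi, O z by exact: open_nbhs_nbhs.
have [_ _ _ _ c] := J _ Oxi.
apply: (@mixed_derivatives_eq _ _ phi xi (direction i) (direction j) (P i) (P j)) => //;
  by near=> z; have /J[_ d1 _ d2 _] : O z by near: z.
Unshelve. all: by end_near.
Qed.

(** A second-order Taylor bound at a critical point in space. The mean value theorem first bounds
    the derivative along the segment at parameter [s] by [- c * s], and is then applied to the
    restriction of [phi] plus [c / 2 * s ^+ 2]. *)
Lemma jet2_below O phi P PP xi v (c : R) : open O -> jet2 O phi P PP ->
  (forall s : R, 0 <= s <= 1 -> O (s *: (v, 0) + xi)) ->
  (forall i, P (Some i) xi = 0) ->
  (forall z, O z ->
    \sum_(i < n) v 0 i * \sum_(j < n) v 0 j * PP (Some i) (Some j) z <= - c) ->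
  phi ((v, 0) + xi) <= phi xi - c / 2.
Proof.
move=> oO J inO P0 PPc.
pose De z := \sum_(j < n) v 0 j * P (Some j) z.
have Oxi : O xi by have := inO 0; rewrite scale0r add0r lexx ler01; apply.
have De0 : De xi = 0 by rewrite /De big1 // => j _; rewrite P0 mulr0.
have DeN (s : R) : 0 <= s <= 1 -> De (s *: (v, 0) + xi) + c * s <= 0.
  move=> /andP[s0 s1].
  have ins (h : R) : 0 <= h <= 1 -> O (h *: (s *: (v, 0)) + xi).
    by move=> /andP[h0 h1]; rewrite scalerA; apply: inO; rewrite mulr_ge0 // mulr_ile1.
  have [h h01] := @MVT_line R S De xi (s *: (v, 0)) (fun z => s *
     \sum_(i < n) v 0 i * \sum_(j < n) v 0 j * PP (Some i) (Some j) z)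
     (fun h h01 => is_derive_scale_dir s (jet2_line v oO J (ins h h01)).2).
  rewrite De0 subr0 => ->; rewrite [c * s]mulrC -mulrDr mulr_ge0_le0 //.
  rewrite -lerBrDr sub0r; apply: PPc; apply: ins.
  by case/andP: h01 => /ltW -> /ltW ->.
pose g (s : R) := phi (s *: (v, 0) + xi) + c / 2 * s ^+ 2.
have dg (s : R) : 0 <= s <= 1 -> is_derive s 1 g (De (s *: (v, 0) + xi) + c * s).
  move=> s01; apply: is_deriveD.
    exact: (is_derive_line_at phi _ _ _ s).1 (jet2_line v oO J (inO s s01)).1.
  by apply: is_derive_eq; rewrite /GRing.scale /=; field.
have [s s01|s s01] := @MVT_line R R g 0 1 (fun s => De (s *: (v, 0) + xi) + c * s).
  by rewrite addr0 [s *: 1]mulr1; exact: dg.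
rewrite !addr0 [s *: 1]mulr1 => E.
have : g 1 - g 0 <= 0.
  by rewrite E; apply: DeN; case/andP: s01 => /ltW -> /ltW ->.
by rewrite /g scale1r scale0r add0r expr1n expr0n /= mulr0; lra.
Qed.

End SpaceLines.

(** * Quadratic forms and radial viscosity solutions *)

(** Over [R[i]] the matrix is Hermitian, so the spectral theorem gives a real diagonal entry with a
    row of the unitary matrix as eigenvector; being an eigenvalue descends to [R]. *)
Lemma real_symmetric_eigenvalue {R : rcfType} n (X : 'M[R]_n) :
  (0 < n)%N -> X^T = X -> exists a, eigenvalue X a.
Proof.
move=> n0 symX; pose iota := real_complex R.
pose Y : 'M[R[i]]_n := map_mx iota X.
have Yreal : Y \is a mxOver Num.real.
  by apply/mxOverP => i j; rewrite mxE; by apply/complex_realP; exists (X i j).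
have Yherm : Y \is hermsymmx.
  apply: realsym_hermsym => //; apply/is_hermitianmxP.
  by rewrite expr0 scale1r map_mx_id // map_trmx symX.
have Dreal := hermitian_spectral_diag_real Yherm.
have /hermitian_normalmx/orthomx_spectralP EY := Yherm.
pose i0 := Ordinal n0.
have /mxOverP/(_ 0 i0)/complex_realP[a Ea] := Dreal.
exists a; rewrite -(eigenvalue_map iota); apply/eigenvalueP.
exists (row i0 (spectralmx Y)).
  rewrite -[map_mx _ _]/Y -row_mul {2}EY !mulmxA mulmxV ?spectral_unit // mul1mx.
  by rewrite row_mul row_diag_mx -scalemxAl -rowE Ea.
apply/eqP => r0; have := spectral_unit Y.
rewrite unitmxE (expand_det_row _ i0) big1 ?unitr0 // => j _.
by move/rowP: r0 => /(_ j); rewrite !mxE => ->; rewrite mul0r.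
Qed.

Section QuadraticForms.
Context {R : realType} {n : nat}.
Implicit Types (X : 'M[R]_n) (v z e : 'rV[R]_n).

Lemma sqnormE v : sqnorm v = (v *m v^T) 0 0.
Proof. by rewrite mxE; apply: eq_bigr => i _; rewrite mxE expr2. Qed.

Lemma sqnorm_ge0 v : 0 <= sqnorm v.
Proof. by apply: sumr_ge0 => i _; exact: sqr_ge0. Qed.

Lemma sqnorm_eq0 v : (sqnorm v == 0) = (v == 0).
Proof.
apply/eqP/eqP => [v0|->]; last by rewrite /sqnorm big1 // => i _; rewrite mxE expr0n.
apply/rowP => i; rewrite mxE; apply/eqP; rewrite -sqrf_eq0; apply/eqP.
by apply: (psumr_eq0P _ v0) => // j _; exact: sqr_ge0.
Qed.

Lemma sqnorm_gt0 v : (0 < sqnorm v) = (v != 0).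
Proof. by rewrite lt_def sqnorm_ge0 andbT sqnorm_eq0. Qed.

Lemma sqnormZ (a : R) v : sqnorm (a *: v) = a ^+ 2 * sqnorm v.
Proof. by rewrite /sqnorm mulr_sumr; apply: eq_bigr => i _; rewrite mxE exprMn. Qed.

Lemma quad_formE X v :
  (v *m X *m v^T) 0 0 = \sum_(i < n) v 0 i * \sum_(j < n) v 0 j * X i j.
Proof.
rewrite -mulmxA mxE; apply: eq_bigr => i _; congr (_ * _).
by rewrite mxE; apply: eq_bigr => j _; rewrite mxE mulrC.
Qed.

(* Conjugating with the projection orthogonal to [e] splits off the direction
   [e] without diagonalising [X]. *)
Lemma negative_form_trace X e : (forall v, (v *m X *m v^T) 0 0 <= 0) ->
  sqnorm e * \tr X <= (e *m X *m e^T) 0 0.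
Proof.
move=> X0; pose W : 'M[R]_n := (sqnorm e)%:M - e^T *m e.
have eeT : e *m e^T = (sqnorm e)%:M by rewrite [LHS]mx11_scalar sqnormE.
have WT : W^T = W by rewrite /W linearB /= tr_scalar_mx trmx_mul trmxK.
have WeT : W *m e^T = 0.
  by rewrite /W mulmxBl -mulmxA eeT mul_scalar_mx mul_mx_scalar subrr.
have WW : W *m W = sqnorm e *: W.
  by rewrite {2}/W mulmxBr mul_mx_scalar mulmxA WeT mul0mx subr0.
have trN : \tr (W *m X *m W) <= 0.
  apply: sumr_le0 => i _.
  have -> : (W *m X *m W) i i = (row i W *m X *m (row i W)^T) 0 0.
    by rewrite tr_row WT -row_mul -row_mul !mxE; apply: eq_bigr => j _; rewrite !mxE.
  exact: X0.
have E : \tr (W *m X *m W) = sqnorm e * (sqnorm e * \tr X - (e *m X *m e^T) 0 0).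
  rewrite mxtrace_mulC mulmxA WW -scalemxAl mxtraceZ /W mulmxBl linearB /=.
  rewrite mul_scalar_mx mxtraceZ; congr (_ * (_ - _)).
  by rewrite -[e^T *m e *m X]mulmxA mxtrace_mulC trace_mx11.
have [e0|] := eqVneq e 0.
  by rewrite e0 !mul0mx mxE; have /eqP -> : sqnorm (0 : 'rV[R]_n) == 0; rewrite ?mul0r
    // sqnorm_eq0.
by rewrite -sqnorm_gt0 => e0; move: trN; rewrite E pmulr_rle0 // subr_le0.
Qed.

Lemma radial_quad_form (a b : R) z v :
  (v *m (a%:M + b *: (z^T *m z)) *m v^T) 0 0 = a * sqnorm v + b * (v *m z^T) 0 0 ^+ 2.
Proof.
rewrite mulmxDr mulmxDl mul_mx_scalar -scalemxAl mxE mxE -sqnormE; congr (_ + _).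
rewrite -scalemxAr -scalemxAl mxE; congr (_ * _).
have -> : v *m (z^T *m z) *m v^T = (v *m z^T) *m (v *m z^T)^T.
  by rewrite trmx_mul trmxK !mulmxA.
by rewrite mxE big_ord1 expr2 [(_^T) _ _]mxE.
Qed.

Lemma trace_radial (a b : R) z : \tr (a%:M + b *: (z^T *m z)) = n%:R * a + b * sqnorm z.
Proof.
by rewrite linearD /= mxtrace_scalar mxtraceZ mxtrace_mulC mulr_natl sqnormE trace_mx11.
Qed.

(** For each eigenvalue [a], [negative_form_trace] applied to [X - mu%:M] gives
    [\tr X - n%:R * mu <= a - mu <= 0], which yields the bound with [a] in place of the extremal
    eigenvalue because [p - 1 > 0]. Taking [inf] for [2 <= p] and [sup] otherwise can only lower the
    left side, so one eigenvalue is enough. *)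
Lemma extremal_eigenvalue_bound (p mu : R) X : (0 < n)%N -> 1 < p -> X^T = X ->
  (forall v, (v *m X *m v^T) 0 0 <= mu * sqnorm v) ->
  \tr X + (p - 2) * extremal_eigenvalue p X <= (n%:R + p - 2) * mu.
Proof.
move=> n0 p1 symX Xmu.
have H a : eigenvalue X a -> \tr X - n%:R * mu <= a - mu /\ a <= mu.
  move=> /eigenvalueP[e eX e0]; rewrite -sqnorm_gt0 in e0.
  have qX v : (v *m (X - mu%:M) *m v^T) 0 0 = (v *m X *m v^T) 0 0 - mu * sqnorm v.
    rewrite mulmxBr mulmxBl mul_mx_scalar -scalemxAl sqnormE.
    by rewrite [LHS]mxE; congr (_ + _); rewrite !mxE.
  have qe : (e *m X *m e^T) 0 0 = a * sqnorm e by rewrite eX -scalemxAl mxE sqnormE.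
  have := @negative_form_trace (X - mu%:M) e.
  rewrite qX qe linearB /= mxtrace_scalar -[mu *+ n]mulr_natl => H.
  split; last by have := Xmu e; rewrite qe ler_pM2r.
  rewrite -(ler_pM2l e0); apply: le_trans (H _) _; last by rewrite le_eqVlt; apply/orP;
    left; apply/eqP; ring.
  by move=> v; rewrite qX subr_le0.
have [a0 /[dup] eva /H[H1 H2]] := real_symmetric_eigenvalue n0 symX.
have Ha0 : \tr X + (p - 2) * a0 <= (n%:R + p - 2) * mu.
  have : (p - 1) * a0 <= (p - 1) * mu by rewrite ler_pM2l // subr_gt0.
  lra.
apply: le_trans Ha0; rewrite lerD2l /extremal_eigenvalue; case: ifPn => p2.
  rewrite ler_wpM2l ?subr_ge0 //; apply: ge_inf => //.
  by exists (\tr X - n%:R * mu + mu) => a /= /H[+ _]; lra.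
rewrite -ltNge in p2; rewrite ler_wnM2l ?subr_le0 ?(ltW p2) //; apply: ub_le_sup => //.
by exists mu => a /= /H[].
Qed.

End QuadraticForms.

Section RadialFunctions.
Context {R : realType} {n : nat}.
Local Notation S := (spacetime R n).
Implicit Types (phi : S -> R) (xi : S) (O : set S) (y : 'rV[R]_n).

(* [phi] is a C^2 function of [sqnorm (x - y)] and [t], whose derivatives with
   respect to these two variables are [F1], [F11] and [Ft]. *)
Definition radial2 O y phi (F1 F11 Ft : S -> R) : Prop :=
  exists P PP, jet2 O phi P PP /\ forall xi, O xi ->
  [/\ forall j, P (Some j) xi = 2 * F1 xi * (xi.1 0 j - y 0 j),
      P None xi = Ft xi
    & forall i j, PP (Some i) (Some j) xi = 2 * F1 xi * (i == j)%:R
        + 4 * F11 xi * (xi.1 0 i - y 0 i) * (xi.1 0 j - y 0 j)].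

Lemma radial2N O y phi F1 F11 Ft : radial2 O y phi F1 F11 Ft ->
  radial2 O y (fun xi => - phi xi) (fun xi => - F1 xi) (fun xi => - F11 xi)
    (fun xi => - Ft xi).
Proof.
move=> [P [PP [J H]]].
exists (fun i xi => - 1 * P i xi), (fun i j xi => - 1 * PP i j xi); split.
  rewrite (_ : (fun xi => - phi xi) = (fun xi => -1 * phi xi)); first exact: jet2Z.
  by apply/funext => xi; rewrite mulN1r.
move=> xi /H[H1 H2 H3]; split=> [j||i j]; rewrite ?H1 ?H2 ?H3; ring.
Qed.

Lemma radial2_subset O O' y phi F1 F11 Ft : O `<=` O' ->
  radial2 O' y phi F1 F11 Ft -> radial2 O y phi F1 F11 Ft.
Proof.
move=> sO [P [PP [J H]]]; exists P, PP; split; first exact: jet2_subset J.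
by move=> xi /sO/H.
Qed.

(** Continuity and finiteness settle all but the touching condition, which is checked here for
    contact that need not be strict. *)
Lemma viscosity_supersolution_continuous p O phi :
  (forall xi, O xi -> {for xi, continuous phi}) ->
  (forall xi0 psi, O xi0 -> C2 O psi -> phi xi0 = psi xi0 ->
     (forall xi, O xi -> psi xi <= phi xi) ->
     (gradient psi xi0 != 0 ->
        normalized_p_laplacian p psi xi0 <= partial None psi xi0) /\
     (gradient psi xi0 = 0 -> laplacian psi xi0
        + (p - 2) * extremal_eigenvalue p (hessian psi xi0) <= partial None psi xi0)) ->
  open O -> viscosity_supersolution p O (EFin \o phi).
Proof.
move=> cphi H oO; split.
- by move=> xi _; exact: ltNyr.
- have cw : {within O, continuous phi} by apply: continuous_in_subspaceT => xi
  /set_mem/cphi.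
  move=> xi a /=; rewrite lte_fin => axi.
  have := cw xi; move=> /cvgr_gt/(_ _ axi) near_gt.
  exists [set z | a < phi z]; first exact: near_gt.
  by move=> z; rewrite /= lte_fin.
- by move=> xi Oxi; apply: subset_closure; split.
- move=> xi0 psi Oxi0 C2psi /= [e0] lt0.
  have [|H1 H2] := H xi0 psi Oxi0 C2psi e0.
    move=> xi Oxi; have [->|ne] := eqVneq xi xi0; first by rewrite e0.
    by rewrite ltW // -lte_fin; exact: lt0.
  split=> g; first by rewrite subr_ge0; exact: H1.
  by rewrite -addrA -opprD subr_ge0; exact: H2.
Qed.

(** At a contact point [psi - phi] is maximal: first derivatives agree and the Hessian of [psi] is
    that of [phi] plus some [X <= 0]. If the gradient [g] is nonzero, [negative_form_trace] bounds
    the contribution of [X] by [p - 1] times the nonpositive quotient of its form at [g] by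
    [sqnorm g]. If it vanishes, [F1 != 0] forces the contact to be at the centre, where the Hessian
    of [phi] is scalar and [extremal_eigenvalue_bound] applies. *)
Lemma radial_supersolution p O y phi F1 F11 Ft : (0 < n)%N -> 1 < p -> open O ->
  radial2 O y phi F1 F11 Ft -> (forall xi, O xi -> F1 xi != 0) ->
  (forall xi, O xi -> 2 * (n%:R + p - 2) * F1 xi
     + 4 * (p - 1) * sqnorm (xi.1 - y) * F11 xi <= Ft xi) ->
  viscosity_supersolution p O (EFin \o phi).
Proof.
move=> n0 p1 oO [P [PP [J HP]]] F10 Feq.
apply: viscosity_supersolution_continuous => //; first by move=> xi /J[].
move=> xi0 psi Oxi0 /C2_jet2 Jpsi e0 lepsi.
have JD := jet2D Jpsi (jet2Z (- 1) J).
have [|gradD quadD] := jet2_local_max oO JD Oxi0.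
  by move=> z /lepsi; rewrite e0; lra.
have [PS PN PPS] := HP _ Oxi0.
pose z := xi0.1 - y; pose mu := 2 * F1 xi0.
have zE j : z 0 j = xi0.1 0 j - y 0 j by rewrite !mxE.
pose Hphi : 'M[R]_n := mu%:M + (4 * F11 xi0) *: (z^T *m z).
have gradE : gradient psi xi0 = mu *: z.
  apply/rowP => j; rewrite !mxE; have := gradD (Some j).
  by rewrite PS /mu; lra.
have timeE : partial None psi xi0 = Ft xi0 by have := gradD None; rewrite PN; lra.
pose X := hessian psi xi0 - Hphi.
have X0 (v : 'rV[R]_n) : (v *m X *m v^T) 0 0 <= 0.
  rewrite quad_formE; apply: le_trans (quadD v); rewrite le_eqVlt; apply/orP; left;
    apply/eqP.
  apply: eq_bigr => i _; congr (_ * _); apply: eq_bigr => j _; congr (_ * _).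
  rewrite !mxE big_ord1 !mxE PPS mulr_natr; congr (_ + _); rewrite mulN1r; congr (- _).
  by rewrite /mu mulrA.
have HE : hessian psi xi0 = X + Hphi by rewrite subrK.
clearbody X.
have symH : (hessian psi xi0)^T = hessian psi xi0.
  by apply/matrixP => i j; rewrite !mxE; exact: (jet2_mixed _ _ oO Jpsi Oxi0).
have Fx := Feq _ Oxi0; rewrite -[xi0.1 - y]/z in Fx.
split=> g0.
  rewrite timeE; apply: le_trans Fx.
  set g := gradient psi xi0 in g0 *.
  have sg : 0 < sqnorm g by rewrite sqnorm_gt0.
  rewrite /normalized_p_laplacian -/g /laplacian HE linearD /= trace_radial.
  have -> : (g *m (X + Hphi) *m g^T) 0 0 = (g *m X *m g^T) 0 0 + (g *m Hphi *m g^T) 0 0.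
    by rewrite mulmxDr mulmxDl mxE.
  rewrite radial_quad_form.
  have -> : (g *m z^T) 0 0 ^+ 2 = sqnorm g * sqnorm z.
    by rewrite /g gradE -scalemxAl mxE -sqnormE sqnormZ; ring.
  have Xtr := negative_form_trace g X0; have Xg := X0 g.
  set q := (g *m X *m g^T) 0 0 in Xtr Xg *.
  have Eq : (sqnorm g)^-1 * q <= 0 by rewrite pmulr_rle0 // invr_gt0.
  have Et : \tr X <= (sqnorm g)^-1 * q by rewrite mulrC ler_pdivlMr // mulrC.
  have -> : (p - 2) * (sqnorm g)^-1 * (q + (mu * sqnorm g + 4 * F11 xi0 * (sqnorm g *
    sqnorm z)))
    = (p - 2) * ((sqnorm g)^-1 * q) + (p - 2) * (mu + 4 * F11 xi0 * sqnorm z).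
    by field; rewrite gt_eqF.
  have : (p - 1) * ((sqnorm g)^-1 * q) <= 0 by rewrite pmulr_rle0 // subr_gt0.
  rewrite /mu; lra.
have z0 : z = 0.
  move: g0; rewrite gradE => /eqP; rewrite scaler_eq0 mulf_eq0 (negPf (F10 _ Oxi0)).
  by rewrite pnatr_eq0 /= => /eqP.
rewrite timeE; apply: le_trans Fx; rewrite z0.
have := @extremal_eigenvalue_bound R n p mu (hessian psi xi0) n0 p1 symH.
rewrite /laplacian /mu => H; apply: le_trans (H _) _.
  move=> v; have := X0 v.
  have -> : (v *m X *m v^T) 0 0 = (v *m hessian psi xi0 *m v^T) 0 0 - (v *m Hphi *m
    v^T) 0 0.
    rewrite HE mulmxDr mulmxDl; set a := v *m X *m _; set b := v *m Hphi *m _.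
    by rewrite [(a + b) 0 0]mxE addrK.
  have v0 : (v *m (0 : 'rV[R]_n)^T) 0 0 = 0 by rewrite trmx0 mulmx0 mxE.
  by rewrite radial_quad_form z0 v0 expr0n /= mulr0 addr0 subr_le0.
have /eqP -> : sqnorm (0 : 'rV[R]_n) == 0 by rewrite sqnorm_eq0.
rewrite mulr0 mul0r addr0.
by rewrite le_eqVlt; apply/orP; left; apply/eqP; ring.
Qed.

Lemma radial_solution p O y phi F1 F11 Ft : (0 < n)%N -> 1 < p -> open O ->
  radial2 O y phi F1 F11 Ft -> (forall xi, O xi -> F1 xi != 0) ->
  (forall xi, O xi -> Ft xi = 2 * (n%:R + p - 2) * F1 xi
     + 4 * (p - 1) * sqnorm (xi.1 - y) * F11 xi) ->
  viscosity_solution p O (EFin \o phi).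
Proof.
move=> n0 p1 oO Hr F10 Feq; split.
  by apply: radial_supersolution Hr F10 _ => // xi /Feq ->.
apply: (radial_supersolution n0 p1 oO (radial2N Hr)) => xi Oxi; first by rewrite
  oppr_eq0 F10.
by rewrite Feq //; lra.
Qed.

End RadialFunctions.

(** * Calculus of radial functions; classical supersolutions are superparabolic *)

Lemma is_derive_inv {R : realType} (x : R) : x != 0 ->
  is_derive x 1 (fun x : R => x^-1) (- x ^- 2).
Proof.
move=> x0; have := @is_deriveV R id x 1 1 x0 (is_derive_id x 1).
by rewrite [_ *: 1]mulr1.
Qed.

Section RadialCalculus.
Context {R : realType} {n : nat}.
Local Notation S := (spacetime R n).
Implicit Types (phi psi : S -> R) (xi : S) (O : set S) (y : 'rV[R]_n).

Lemma radial2_ext O y phi psi F1 F11 Ft G1 G11 Gt : radial2 O y phi F1 F11 Ft ->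
  (forall xi, phi xi = psi xi) ->
  (forall xi, O xi -> [/\ F1 xi = G1 xi, F11 xi = G11 xi & Ft xi = Gt xi]) ->
  radial2 O y psi G1 G11 Gt.
Proof.
move=> [P [PP [J H]]] /funext <- E; exists P, PP; split=> // xi Oxi.
by have [<- <- <-] := E _ Oxi; exact: H.
Qed.

Lemma radial2_cst O y (c : R) :
  radial2 O y (fun=> c) (fun=> 0) (fun=> 0) (fun=> 0).
Proof.
exists (fun _ _ => 0), (fun _ _ _ => 0); split; first exact: jet2_cst.
by move=> xi _; split=> *; ring.
Qed.

Lemma radial2D O y phi psi F1 F11 Ft G1 G11 Gt :
  radial2 O y phi F1 F11 Ft -> radial2 O y psi G1 G11 Gt ->
  radial2 O y (fun xi => phi xi + psi xi) (fun xi => F1 xi + G1 xi)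
    (fun xi => F11 xi + G11 xi) (fun xi => Ft xi + Gt xi).
Proof.
move=> [P [PP [J H]]] [P' [PP' [J' H']]].
exists (fun i xi => P i xi + P' i xi), (fun i j xi => PP i j xi + PP' i j xi).
split; first exact: jet2D.
move=> xi Oxi; have [H1 H2 H3] := H xi Oxi; have [H1' H2' H3'] := H' xi Oxi.
by split=> [j||i j]; rewrite ?H1 ?H2 ?H3 ?H1' ?H2' ?H3'; ring.
Qed.

Lemma radial2M O y phi psi F1 F11 Ft G1 G11 Gt :
  radial2 O y phi F1 F11 Ft -> radial2 O y psi G1 G11 Gt ->
  radial2 O y (fun xi => phi xi * psi xi)
    (fun xi => phi xi * G1 xi + psi xi * F1 xi)
    (fun xi => phi xi * G11 xi + 2 * F1 xi * G1 xi + psi xi * F11 xi)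
    (fun xi => phi xi * Gt xi + psi xi * Ft xi).
Proof.
move=> [P [PP [J H]]] [P' [PP' [J' H']]].
exists (fun i xi => phi xi * P' i xi + psi xi * P i xi),
  (fun i j xi => (phi xi * PP' i j xi + P' i xi * P j xi)
               + (psi xi * PP i j xi + P i xi * P' j xi)).
split; first exact: jet2M.
move=> xi Oxi; have [H1 H2 H3] := H xi Oxi; have [H1' H2' H3'] := H' xi Oxi.
by split=> [j||i j]; rewrite ?H1 ?H2 ?H3 ?H1' ?H2' ?H3'; ring.
Qed.

Lemma radial2_comp O y phi F1 F11 Ft (f f1 f2 : R -> R) :
  radial2 O y phi F1 F11 Ft ->
  (forall xi, O xi -> [/\ is_derive (phi xi) 1 f (f1 (phi xi)),
     is_derive (phi xi) 1 f1 (f2 (phi xi)) & {for phi xi, continuous f2}]) ->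
  radial2 O y (fun xi => f (phi xi)) (fun xi => f1 (phi xi) * F1 xi)
    (fun xi => f1 (phi xi) * F11 xi + f2 (phi xi) * F1 xi ^+ 2)
    (fun xi => f1 (phi xi) * Ft xi).
Proof.
move=> [P [PP [J H]]] Hf.
exists (fun i xi => f1 (phi xi) * P i xi),
  (fun i j xi => f1 (phi xi) * PP i j xi + P i xi * (f2 (phi xi) * P j xi)).
split; first exact: jet2_comp.
move=> xi Oxi; have [H1 H2 H3] := H xi Oxi.
by split=> [j||i j]; rewrite ?H1 ?H2 ?H3; ring.
Qed.

Lemma radial2Z O y phi F1 F11 Ft (c : R) : radial2 O y phi F1 F11 Ft ->
  radial2 O y (fun xi => c * phi xi) (fun xi => c * F1 xi)
    (fun xi => c * F11 xi) (fun xi => c * Ft xi).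
Proof.
move=> h; apply: radial2_ext (radial2M (radial2_cst O y c) h) _ _ => // xi _.
by split; ring.
Qed.

Lemma radial2_time O y :
  radial2 O y (fun xi => xi.2) (fun=> 0) (fun=> 0) (fun=> 1).
Proof.
exists (fun i _ => (i == None)%:R), (fun _ _ _ => 0); split; first exact: jet2_time.
by move=> xi _; split=> *; rewrite /=; ring.
Qed.

Lemma radial2_sqnorm O y :
  radial2 O y (fun xi => sqnorm (xi.1 - y)) (fun=> 1) (fun=> 0) (fun=> 0).
Proof.
do 2!eexists; split; first exact: jet2_sqnorm.
by move=> xi _; split=> [j||i j] //=; rewrite ?andbT; [ring|rewrite (_ : (Some i ==
  Some j) = (i == j)) //; ring].
Qed.

Lemma radial2V O y phi F1 F11 Ft : radial2 O y phi F1 F11 Ft ->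
  (forall xi, O xi -> phi xi != 0) ->
  radial2 O y (fun xi => (phi xi)^-1) (fun xi => - F1 xi / phi xi ^+ 2)
    (fun xi => - F11 xi / phi xi ^+ 2 + 2 * F1 xi ^+ 2 / phi xi ^+ 3)
    (fun xi => - Ft xi / phi xi ^+ 2).
Proof.
move=> h h0.
have dV := @is_derive_inv R.
have dV2 (x : R) : x != 0 -> is_derive x 1 (fun x : R => - x ^- 2) (2 * x ^- 3).
  move=> x0; have d := dV x x0.
  have d2 := is_deriveM d d.
  rewrite (_ : (fun x : R => - x ^- 2) = - ((fun x : R => x^-1) * (fun x : R => x^-1))).
    apply: is_derive_eq; rewrite /GRing.scale /=; field; exact: x0.
  by apply/funext => z; rewrite /= [LHS]/(- (z ^+ 2)^-1) expr2 invfM.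
have c3 (x : R) : x != 0 -> {for x, continuous (fun x : R => 2 * x ^- 3)}.
  move=> x0; apply: continuousM; first exact: cvg_cst.
  apply: (@continuous_comp _ _ _ (fun x : R => x ^+ 3) (fun x => x^-1)).
    exact: exprn_continuous.
  by apply: inv_continuous; rewrite expf_neq0.
have hc xi : O xi -> [/\ is_derive (phi xi) 1 (fun x : R => x^-1) (- phi xi ^- 2),
    is_derive (phi xi) 1 (fun x : R => - x ^- 2) (2 * phi xi ^- 3)
    & {for phi xi, continuous (fun x : R => 2 * x ^- 3)}].
  by move=> /h0 hx; split; [exact: dV|exact: dV2|exact: c3].
apply: radial2_ext (radial2_comp (f1 := fun x => - x ^- 2) (f2 := fun x => 2 * x ^- 3)
  h hc) _ _ => // xi /h0 hx.
by split; field.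
Qed.

(** A perturbation in time only: it leaves the space derivatives alone and, for [M > 0], makes a
    differential inequality strict. *)
Lemma radial2_pole O y (T M : R) : (forall xi, O xi -> xi.2 < T) ->
  radial2 O y (fun xi => M / (T - xi.2)) (fun=> 0) (fun=> 0)
    (fun xi => M / (T - xi.2) ^+ 2).
Proof.
move=> OT; have := radial2D (radial2_cst O y T) (radial2N (radial2_time O y)).
move=> /radial2V /= h; have T0 xi : O xi -> T - xi.2 != 0.
  by move=> /OT ?; rewrite subr_eq0 gt_eqF.
apply: radial2_ext (radial2Z M (h T0)) _ _ => // xi /T0 ?.
by split; field.
Qed.

Lemma radial2_expR O y phi F1 F11 Ft : radial2 O y phi F1 F11 Ft ->
  radial2 O y (fun xi => expR (phi xi)) (fun xi => expR (phi xi) * F1 xi)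
    (fun xi => expR (phi xi) * (F11 xi + F1 xi ^+ 2))
    (fun xi => expR (phi xi) * Ft xi).
Proof.
move=> h.
have hc xi : O xi -> [/\ is_derive (phi xi) 1 expR (expR (phi xi)),
    is_derive (phi xi) 1 expR (expR (phi xi)) & {for phi xi, continuous (@expR R)}].
  by split; [exact: is_derive_expR|exact: is_derive_expR|exact: continuous_expR].
by apply: radial2_ext (radial2_comp h hc) _ _ => // xi _; split; ring.
Qed.

Lemma radial2_ln O y phi F1 F11 Ft : radial2 O y phi F1 F11 Ft ->
  (forall xi, O xi -> 0 < phi xi) ->
  radial2 O y (fun xi => ln (phi xi)) (fun xi => F1 xi / phi xi)
    (fun xi => F11 xi / phi xi - F1 xi ^+ 2 / phi xi ^+ 2)
    (fun xi => Ft xi / phi xi).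
Proof.
move=> h h0.
have hc xi : O xi -> [/\ is_derive (phi xi) 1 (@ln R) (phi xi)^-1,
    is_derive (phi xi) 1 (fun x : R => x^-1) (- phi xi ^- 2)
    & {for phi xi, continuous (fun x : R => - x ^- 2)}].
  move=> /h0 hx; split; first exact: is_derive1_ln.
    exact: is_derive_inv (lt0r_neq0 hx).
  apply: (@continuousN _ _ _ (fun x : R => x ^- 2)).
  apply: (@continuous_comp _ _ _ (fun x : R => x ^+ 2) (fun x => x^-1)).
    exact: exprn_continuous.
  by apply: inv_continuous; rewrite expf_neq0 // gt_eqF.
apply: radial2_ext (radial2_comp (f1 := fun x => x^-1) (f2 := fun x => - x ^- 2) h hc)
  _ _ => // xi /h0 hx.
by split; field; rewrite gt_eqF.
Qed.

(** The gradient is parallel to [z], an eigenvector of the Hessian with eigenvalue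
    [mu + b * sqnorm z], so the normalized term becomes linear. *)
Lemma radial_normalized_p_laplacian p phi xi (mu b : R) (z : 'rV[R]_n) :
  gradient phi xi = mu *: z -> hessian phi xi = mu%:M + b *: (z^T *m z) ->
  gradient phi xi != 0 ->
  normalized_p_laplacian p phi xi = (n%:R + p - 2) * mu + (p - 1) * b * sqnorm z.
Proof.
move=> gE HE g0; rewrite /normalized_p_laplacian /laplacian HE trace_radial
  radial_quad_form.
have -> : (gradient phi xi *m z^T) 0 0 ^+ 2 = sqnorm (gradient phi xi) * sqnorm z.
  by rewrite gE -scalemxAl mxE -sqnormE sqnormZ; ring.
by field; rewrite sqnorm_eq0.
Qed.

Lemma extremal_eigenvalue_scalar p (mu : R) : (0 < n)%N ->
  extremal_eigenvalue p (mu%:M : 'M[R]_n) = mu.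
Proof.
move=> n0; rewrite /extremal_eigenvalue.
have -> : [set a | eigenvalue (mu%:M : 'M[R]_n) a] = [set mu].
  apply/seteqP; split=> a /=.
    move=> /eigenvalueP[e]; rewrite mul_mx_scalar => /eqP.
    by rewrite -subr_eq0 -scalerBl scaler_eq0 subr_eq0 => /orP[/eqP->//|->].
  move=> ->; apply/eigenvalueP; exists (const_mx 1); first by rewrite mul_mx_scalar.
  by apply/eqP => /rowP/(_ (Ordinal n0)); rewrite !mxE => /eqP; rewrite oner_eq0.
by rewrite inf1 sup1 if_same.
Qed.

Lemma closure_setX_sub (T U : topologicalType) (A : set T) (B : set U) :
  closure (A `*` B) `<=` closure A `*` closure B.
Proof.
move=> [x t] cl; split=> V nV.
  have [|[x' t'] /= [[? _] ?]] := cl (fst @^-1` V); first exact: cvg_fst.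
  by exists x'.
have [|[x' t'] /= [[_ ?] ?]] := cl (snd @^-1` V); first exact: cvg_snd.
by exists t'.
Qed.

(** Besides the open box and the parabolic boundary, the closure contains the interior of the top
    face. *)
Lemma closure_spacetime_box (a b : 'rV[R]_n) (t1 t2 : R) xi :
  closure (spacetime_box a b t1 t2) xi ->
  [\/ parabolic_boundary a b t1 t2 xi, spacetime_box a b t1 t2 xi | xi.2 = t2].
Proof.
move=> /closure_setX_sub[cx ct].
have : t1 <= xi.2 <= t2.
  have : closed [set t : R | t1 <= t <= t2].
    rewrite (_ : [set _ | _] = `[t1, t2]%classic); first exact: itv_closed.
    by apply/seteqP; split=> t /=; rewrite in_itv.
  by apply; apply: closure_subset ct => t /= /andP[/ltW -> /ltW ->].
move=> t12; have [bx|nbx] := pselect (box a b xi.1); last first.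
  apply: Or31; right; split=> //; split=> // ib; apply: nbx.
  exact: (@interior_subset _ (box a b)).
move: t12 => /andP[]; rewrite le_eqVlt => /orP[/eqP t1E|t1t].
  by move=> _; apply: Or31; left; split.
rewrite le_eqVlt => /orP[/eqP ->|tt2]; first exact: Or33.
by apply: Or32; split=> //=; rewrite t1t tt2.
Qed.

Lemma open_spacetime_box (a b : 'rV[R]_n) (t1 t2 : R) :
  open (spacetime_box a b t1 t2).
Proof.
rewrite openE => xi [bx /andP[t1x xt2]]; rewrite /interior.
have nb : nbhs xi [set z : S | forall i, a 0 i < z.1 0 i < b 0 i].
  have := @filter_forall S 'I_n (fun i => [set z : S | a 0 i < z.1 0 i < b 0 i]) (nbhs
    xi) (nbhs_filter xi).
  apply=> i.
  have /andP[ax xb] := bx i; have ci := @continuous_space R n xi i.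
  apply: (@filterS _ (nbhs xi) (nbhs_filter xi) _ _ _ (filterI (cvgr_gt _ ci _ ax)
    (cvgr_lt _ ci _ xb))).
  by move=> z /= [-> ->].
have nt : nbhs xi [set z : S | t1 < z.2 < t2].
  have ct : {for xi, continuous (fun z : S => z.2)} by exact: cvg_snd.
  apply: (@filterS _ (nbhs xi) (nbhs_filter xi) _ _ _ (filterI (cvgr_gt _ ct _ t1x)
    (cvgr_lt _ ct _ xt2))).
  by move=> z /= [-> ->].
exact: filterI nb nt.
Qed.

(** If [h > w] somewhere, then at a positive maximum [M] of [(t2 - t) * (h - w)] the function
    [w + M / (t2 - t)] touches [h] from above. The subsolution property of [h] there contradicts the
    inequality for [w] by the amount [M / (t2 - t) ^+ 2]. *)
Lemma classical_superparabolic p (Theta : set S) y w F1 F11 Ft :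
  (0 < n)%N -> 1 < p -> open Theta -> radial2 Theta y w F1 F11 Ft ->
  (forall xi, Theta xi -> F1 xi != 0) ->
  (forall xi, Theta xi -> 2 * (n%:R + p - 2) * F1 xi
     + 4 * (p - 1) * sqnorm (xi.1 - y) * F11 xi <= Ft xi) ->
  superparabolic p Theta (EFin \o w).
Proof.
move=> n0 p1 oT rw F10 Feq.
have [A1 A2 A3 _] := radial_supersolution n0 p1 oT rw F10 Feq.
split=> // a b t1 t2 ab t12 Q cQ QT h ch [_ [_ _ _ hsub]] hw xis Qxis.
rewrite lee_fin leNgt; apply/negP => whs.
have oQ : open Q by exact: open_spacetime_box.
have QsT : Q `<=` Theta by move=> xi /subset_closure/QT.
(* The factor [t2 - t] keeps a positive maximum away from the top of the box. *)
pose g xi := (t2 - xi.2) * (h xi - w xi).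
have cg : {within closure Q, continuous g}.
  have cw : {within closure Q, continuous w}.
    by apply: continuous_in_subspaceT => xi /set_mem/QT; have [P [PP [J _]]] := rw =>
      /J[].
  have ct : {within closure Q, continuous (fun xi : S => t2 - xi.2)}.
    apply: continuous_subspaceT => xi; apply: continuousB; [exact: cvg_cst|exact:
      cvg_snd].
  have chw : {within closure Q, continuous (fun xi : S => h xi - w xi)}.
    move=> xi; exact: (@continuousB R R (subspace (closure Q)) h w xi (ch xi) (cw xi)).
  move=> xi; exact: (@continuousM R (subspace (closure Q)) (fun xi : S => t2 - xi.2) _
    xi (ct xi) (chw xi)).
have Q0 : closure Q !=set0 by exists xis; exact: subset_closure.
have [xi1 /set_mem cl1 max1] := compact_EVT_max Q0 cQ cg.
have gs0 : 0 < g xis.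
  rewrite mulr_gt0 // subr_gt0 //.
  by case: Qxis => _ /= /andP[].
have g10 : 0 < g xi1.
  by apply: lt_le_trans gs0 _; apply: max1; rewrite inE; exact: subset_closure.
have Q1 : Q xi1.
  case: (closure_spacetime_box cl1) => // [/hw|t2E].
    rewrite lee_fin -subr_le0 => hw1; move: g10; rewrite ltNge => /negP[].
    rewrite mulr_ge0_le0 // subr_ge0.
    have [_ /=] := closure_setX_sub cl1; move=> ct1.
    have : closed [set t : R | t <= t2] by exact: closed_le.
    by apply; apply: closure_subset ct1 => t /= /andP[_ /ltW].
  by move: g10; rewrite /g t2E subrr mul0r ltxx.
have tQ xi : Q xi -> xi.2 < t2 by case=> _ /= /andP[].
pose M := g xi1.
have rpsi := radial2N (radial2D (radial2_subset QsT rw) (radial2_pole y M tQ)).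
(* Subtracting a quartic penalty makes the contact strict without changing the
   derivatives at [xi1]. *)
have rt1 := radial2D (radial2_time Q xi1.1) (radial2_cst Q xi1.1 (- xi1.2)).
have rpen := radial2N (radial2D (radial2M (radial2_sqnorm Q xi1.1) (radial2_sqnorm Q
  xi1.1))
                        (radial2M rt1 rt1)).
have [P [PP [J HJ]]] := rpsi; have [P' [PP' [J' HJ']]] := rpen.
have [C2psi] := jet2_C2 oQ (jet2D J J').
set psi := (X in C2 Q X) in C2psi * => E1 E2.
have [PS PN PPS] := HJ _ Q1; have [PS' PN' PPS'] := HJ' _ Q1.
pose z := xi1.1 - y; pose mu := - 2 * F1 xi1.
have s0 : sqnorm (xi1.1 - xi1.1) = 0 by apply/eqP; rewrite sqnorm_eq0 subrr.
have gradE : gradient psi xi1 = mu *: z.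
  apply/rowP => j; rewrite !mxE E1 // PS PS' s0 /mu; ring.
have timeE : partial None psi xi1 = - Ft xi1 - M / (t2 - xi1.2) ^+ 2.
  by rewrite E1 // PN PN'; ring.
have hessE : hessian psi xi1 = mu%:M + (- 4 * F11 xi1) *: (z^T *m z).
  apply/matrixP => i j; rewrite !mxE big_ord1 !mxE E2 // PPS PPS' s0 /mu !subrr.
  rewrite -[in RHS]mulr_natr; ring.
have F1z := F10 _ (QsT _ Q1); have F1eq := Feq _ (QsT _ Q1); rewrite -[xi1.1 - y]/z in
  F1eq.
have Mpos : 0 < M / (t2 - xi1.2) ^+ 2.
  by rewrite divr_gt0 // exprn_gt0 // subr_gt0; exact: tQ.
have [||H1 H2] := hsub xi1 psi Q1 C2psi.
- congr (EFin _); rewrite /psi /M /g s0; field; by rewrite subr_eq0 gt_eqF ?tQ.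
- move=> xi Qxi ne; rewrite /= lte_fin /psi.
  have tx := tQ _ Qxi.
  have : h xi - w xi <= M / (t2 - xi.2).
    rewrite ler_pdivlMr ?subr_gt0 // mulrC; apply: max1; rewrite inE; exact:
      subset_closure.
  suff : 0 < sqnorm (xi.1 - xi1.1) * sqnorm (xi.1 - xi1.1) + (xi.2 + - xi1.2) * (xi.2 +
    - xi1.2) by lra.
  rewrite -!expr2; have [x1|] := eqVneq xi.1 xi1.1.
    rewrite ltr_wpDl ?sqr_ge0 // exprn_even_gt0 //= subr_eq0.
    apply: contra ne => /eqP t1E; apply/eqP; exact: injective_projections.
  rewrite -subr_eq0 -sqnorm_gt0 => sp; rewrite ltr_wpDr ?sqr_ge0 // exprn_gt0 //.
(* As [F1] has no zero, the gradient vanishes only at the centre [y], where the Hessian is scalar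
   and its extremal eigenvalue is explicit. *)
have [gz|gnz] := eqVneq (gradient psi xi1) 0.
  have z0 : z = 0.
    move: gz; rewrite gradE => /eqP; rewrite scaler_eq0 mulf_eq0 (negPf F1z) orbF.
    by rewrite oppr_eq0 pnatr_eq0 /= => /eqP.
  move: hessE (H2 gz); rewrite /laplacian timeE z0 mulmx0 scaler0 addr0 => ->.
  rewrite extremal_eigenvalue_scalar // mxtrace_scalar -[mu *+ n]mulr_natl.
  move: F1eq; rewrite z0 (eqP (_ : sqnorm (0 : 'rV[R]_n) == 0)) ?sqnorm_eq0 // /mu; lra.
have := H1 gnz; rewrite timeE (radial_normalized_p_laplacian p gradE hessE gnz) /mu; lra.
Qed.

End RadialCalculus.

(** * Touching on small boxes *)

Section Touching.
Context {R : realType} {n : nat}.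
Local Notation S := (spacetime R n).
Implicit Types (phi psi : S -> R) (xi : S) (O : set S) (x y : 'rV[R]_n).

Definition closed_box (a b : 'rV[R]_n) : set 'rV[R]_n :=
  [set x | forall i, x 0 i \in `[a 0 i, b 0 i]].

Lemma compact_closed_box a b : compact (closed_box a b).
Proof.
have := @rV_compact R n (fun i => `[a 0 i, b 0 i]%classic).
by apply=> i; exact: segment_compact.
Qed.

Lemma open_box (a b : 'rV[R]_n) : open (box a b).
Proof.
rewrite (_ : box a b = (fun x : 'rV[R]_n => (x, 0 : R) : S) @^-1` spacetime_box a b
  (-1) 1).
  apply: open_comp; last exact: open_spacetime_box.
  move=> x _; exact: (@cvg_pair _ _ _ (nbhs x) (nbhs x) (nbhs (0 : R)) _ _ _ id (fun=>
    0 : R)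
    (@cvg_id _ _) (@cvg_cst _ _ _ _ _)).
apply/seteqP; split=> x /=; last by case.
by move=> bx; split=> //=; rewrite ltrN10 ltr01.
Qed.

Lemma closure_box_sub (a b : 'rV[R]_n) : closure (box a b) `<=` closed_box a b.
Proof.
have : closed (closed_box a b) := compact_closed (@norm_hausdorff _ _)
  (@compact_closed_box a b).
move=> cb x cx; apply: cb; apply: closure_subset cx => z bz i.
by have /andP[/ltW h1 /ltW h2] := bz i; rewrite in_itv /= h1.
Qed.

Lemma closure_spacetime_box_sub (a b : 'rV[R]_n) (t1 t2 : R) :
  closure (spacetime_box a b t1 t2) `<=` closed_box a b `*` `[t1, t2].
Proof.
move=> xi /closure_setX_sub[/closure_box_sub cx ct]; split=> //.
have : closed `[t1, t2]%classic by exact: itv_closed.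
apply; apply: closure_subset ct => t /= /andP[/ltW h1 /ltW h2].
by rewrite in_itv /= h1.
Qed.

Lemma compact_closure_spacetime_box (a b : 'rV[R]_n) (t1 t2 : R) :
  compact (closure (spacetime_box a b t1 t2)).
Proof.
apply: subclosed_compact (@closure_spacetime_box_sub a b t1 t2); first exact:
  closed_closure.
by apply: compact_setX; [exact: compact_closed_box|exact: segment_compact].
Qed.

Lemma parabolic_boundaryP (a b : 'rV[R]_n) (t1 t2 : R) xi : t1 < t2 ->
  parabolic_boundary a b t1 t2 xi ->
  [/\ closed_box a b xi.1, t1 <= xi.2 <= t2
    & xi.2 = t1 \/ exists i, xi.1 0 i = a 0 i \/ xi.1 0 i = b 0 i].
Proof.
move=> t12 [[bx ->]|[[cx /= ib] t12x]].
  split; [|by rewrite lexx ltW|by left].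
  by move=> i; have /andP[/ltW h1 /ltW h2] := bx i; rewrite in_itv /= h1.
split=> //; first exact: closure_box_sub.
right; apply: contrapT => /forallNP nE; apply: ib.
apply: open_nbhs_nbhs; split; first exact: open_box.
move=> i; have := nE i => /not_orP[/eqP/negPf na /eqP/negPf nb].
have := closure_box_sub cx i; rewrite in_itv /= => /andP[].
by rewrite !le_eqVlt eq_sym na nb /= => -> ->.
Qed.

Definition shift_vec (x : 'rV[R]_n) (r : R) : 'rV[R]_n := \row_i (x 0 i + r).

(** A ball of the sup norm in the shape of a space-time box, so that the openness of boxes applies
    to it. *)
Definition cube xi (r : R) : set S :=
  spacetime_box (shift_vec xi.1 (- r)) (shift_vec xi.1 r) (xi.2 - r) (xi.2 + r).

Lemma cubeP xi (r : R) z : cube xi r z <->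
  (forall i, `|z.1 0 i - xi.1 0 i| < r) /\ `|z.2 - xi.2| < r.
Proof.
rewrite ltr_distl; split=> -[H1 H2]; split=> // i; have := H1 i.
  by rewrite !mxE ltr_distl.
by rewrite !mxE ltr_distl.
Qed.

Lemma nbhs_cube xi (A : set S) : nbhs xi A -> exists2 r : R, 0 < r & cube xi r `<=` A.
Proof.
move=> /nbhs_ballP[r r0 H]; exists r => // z /cubeP[H1 H2]; apply: H; split.
  by split=> // i j; rewrite /ball /= (ord1 i) distrC.
by rewrite /ball /= distrC.
Qed.

(** The last function is the linear radial operator applied to the polynomial, so the equation
    holds; [c1] makes the coefficients of [sqnorm (xi.1 - y)] match. The free [alpha], [beta] and
    [gamma] prescribe the value and the first and second radial derivatives at one point. *)
Lemma caloric_polynomial y (p t0 alpha beta gamma : R) :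
  let c1 := 4 * (n%:R + p - 2 + 2 * (p - 1)) in
  radial2 [set: S] y
    (fun xi => alpha + (beta * (sqnorm (xi.1 - y) + 2 * (n%:R + p - 2) * (xi.2 - t0))
       + gamma * (sqnorm (xi.1 - y) ^+ 2 + c1 * sqnorm (xi.1 - y) * (xi.2 - t0)
                  + (n%:R + p - 2) * c1 * (xi.2 - t0) ^+ 2)))
    (fun xi => beta + gamma * (2 * sqnorm (xi.1 - y) + c1 * (xi.2 - t0)))
    (fun=> 2 * gamma)
    (fun xi => 2 * (n%:R + p - 2) * (beta + gamma * (2 * sqnorm (xi.1 - y) + c1 * (xi.2
      - t0)))
       + 4 * (p - 1) * sqnorm (xi.1 - y) * (2 * gamma)).
Proof.
move=> c1.
have s := radial2_sqnorm [set: S] y.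
have t := radial2D (radial2_time [set: S] y) (radial2_cst [set: S] y (- t0)).
have h1 := radial2Z beta (radial2D s (radial2Z (2 * (n%:R + p - 2)) t)).
have h2 := radial2Z gamma (radial2D (radial2D (radial2M s s) (radial2M (radial2Z c1 s) t))
  (radial2Z ((n%:R + p - 2) * c1) (radial2M t t))).
apply: radial2_ext (radial2D (radial2_cst [set: S] y alpha) (radial2D h1 h2)) _ _.
  by move=> xi; rewrite !expr2.
by move=> xi _; rewrite /c1; split; ring.
Qed.

(** The matrix is entrywise within [eta / (2 * n%:R)] of [- eta] times the identity; by
    [2 |v_i v_j| <= v_i^2 + v_j^2] the perturbation costs at most half of [eta * sqnorm v]. *)
Lemma almost_negative_form (PP : 'I_n -> 'I_n -> R) (eta : R) (v : 'rV[R]_n) :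
  0 < eta -> (0 < n)%N ->
  (forall i j, `|PP i j + eta * (i == j)%:R| <= eta / (2 * n%:R)) ->
  \sum_(i < n) v 0 i * \sum_(j < n) v 0 j * PP i j <= - (eta / 2 * sqnorm v).
Proof.
move=> eta0 n0 HP; have nR : 0 < n%:R :> R by rewrite ltr0n.
pose d := eta / (2 * n%:R).
have d0 : 0 < d by rewrite divr_gt0 // mulr_gt0.
have bnd i j : v 0 i * (v 0 j * PP i j) <=
    d * ((v 0 i ^+ 2 + v 0 j ^+ 2) / 2) - eta * (v 0 i * (v 0 j * (i == j)%:R)).
  have -> : v 0 i * (v 0 j * PP i j) = v 0 i * v 0 j * (PP i j + eta * (i == j)%:R)
      - eta * (v 0 i * (v 0 j * (i == j)%:R)) by ring.
  rewrite lerD2r.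
  apply: le_trans (ler_norm _) _; rewrite normrM [X in X <= _]mulrC.
  apply: ler_pM => //.
  rewrite normrM -(real_normK (num_real (v 0 i))) -(real_normK (num_real (v 0 j))).
  have := sqr_ge0 (`|v 0 i| - `|v 0 j|); nra.
have : \sum_(i < n) v 0 i * \sum_(j < n) v 0 j * PP i j <=
    \sum_(i < n) \sum_(j < n) (d * ((v 0 i ^+ 2 + v 0 j ^+ 2) / 2) - eta * (v 0 i * (v
      0 j * (i == j)%:R))).
  by apply: ler_sum => i _; rewrite mulr_sumr; apply: ler_sum => j _; exact: bnd.
move/le_trans; apply.
have -> : \sum_(i < n) \sum_(j < n) (d * ((v 0 i ^+ 2 + v 0 j ^+ 2) / 2) - eta * (v 0 i
  * (v 0 j * (i == j)%:R)))
   = d * (n%:R * sqnorm v) - eta * sqnorm v.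
  have E1 i : \sum_(j < n) (d * ((v 0 i ^+ 2 + v 0 j ^+ 2) / 2) - eta * (v 0 i * (v 0 j
    * (i == j)%:R)))
     = d / 2 * (n%:R * v 0 i ^+ 2 + sqnorm v) - eta * v 0 i ^+ 2.
    rewrite sumrB; congr (_ - _).
      rewrite (eq_bigr (fun j => d / 2 * (v 0 i ^+ 2 + v 0 j ^+ 2))); last by move=> j
        _; field.
      by rewrite -mulr_sumr big_split /= sumr_const card_ord mulr_natl.
    rewrite (bigD1 i) //= eqxx mulr1 big1 ?addr0 ?expr2 // => j /negPf ji.
    by rewrite eq_sym ji !mulr0.
  rewrite (eq_bigr _ (fun i _ => E1 i)) sumrB -!mulr_sumr big_split /= sumr_const
    card_ord.
  by rewrite -mulr_sumr -/(sqnorm v) -[sqnorm v *+ n]mulr_natl; field.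
rewrite le_eqVlt; apply/orP; left; apply/eqP; rewrite /d; field; exact: lt0r_neq0.
Qed.

Lemma radial2_continuous O y phi F1 F11 Ft xi : radial2 O y phi F1 F11 Ft -> O xi ->
  {for xi, continuous phi}.
Proof. by move=> [P [PP [J _]]] /J[]. Qed.

Lemma cube_line xi (r s : R) z : cube xi r z -> 0 <= s <= 1 ->
  cube xi r (s *: (z - xi) + xi).
Proof.
move=> /cubeP[H1 H2] /andP[s0 s1]; apply/cubeP; split=> [i|].
  rewrite /= !mxE addrK normrM ger0_norm //; apply: le_lt_trans (H1 i).
  by rewrite ler_piMl.
rewrite /= addrK [s *: _]/(s * _) normrM ger0_norm //; apply: le_lt_trans H2.
by rewrite ler_piMl.
Qed.

Lemma sqnorm_coord_le x i : x 0 i ^+ 2 <= sqnorm x.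
Proof.
rewrite /sqnorm (bigD1 i) //= lerDl; apply: sumr_ge0 => j _; exact: sqr_ge0.
Qed.

Section QuadraticTouching.
Variables (G : set S) (D : S -> R) (DP : option 'I_n -> S -> R)
  (DPP : option 'I_n -> option 'I_n -> S -> R) (xi0 : S) (r eta th : R).
Hypotheses (n0 : (0 < n)%N) (r0 : 0 < r) (eta0 : 0 < eta) (th0 : 0 < th).
Hypothesis GE : G = cube xi0 r.
Hypothesis J : jet2 G D DP DPP.
Hypothesis D0 : D xi0 = 0.
Hypothesis DP0 : forall i, DP (Some i) xi0 = 0.
Hypothesis DPPG : forall z, G z -> forall i j : 'I_n,
  `|DPP (Some i) (Some j) z + eta * (i == j)%:R| <= eta / (2 * n%:R).
Hypothesis DPG : forall z, G z -> th / 2 <= DP None z <= 2 * th.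

Let oG : open G. Proof. rewrite GE; exact: open_spacetime_box. Qed.

Let space_bound x : G (x, xi0.2) -> D (x, xi0.2) <= - (eta / 4 * sqnorm (x - xi0.1)).
Proof.
move=> Gx.
have E : (x - xi0.1, 0) + xi0 = (x, xi0.2) :> S.
  by apply: injective_projections; rewrite /= ?subrK ?add0r.
have := @jet2_below R n G D DP DPP xi0 (x - xi0.1) (eta / 2 * sqnorm (x - xi0.1)) oG J.
rewrite E D0 => H; apply: le_trans (H _ _ _) _ => //; last by lra.
  move=> s s01; rewrite GE in Gx *; have := cube_line Gx s01.
  by rewrite (_ : (x, xi0.2) - xi0 = (x - xi0.1, 0)) //; apply: injective_projections;
    rewrite //= subrr.
by move=> z Gz; apply: (@almost_negative_form (fun i j => DPP (Some i) (Some j) z)) =>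
  //; exact: DPPG.
Qed.

Let time_bound x (t t' : R) : G (x, t) -> G (x, t') -> t <= t' ->
  th / 2 * (t' - t) <= D (x, t') - D (x, t) <= 2 * th * (t' - t).
Proof.
move=> G1 G2 tt'.
have E (s : R) : s *: ((t' - t) *: direction R None : S) + (x, t) = (x, s * (t' - t) +
  t) :> S.
  apply: injective_projections; rewrite /= ?scaler0 ?add0r //.
  by rewrite [_ *: 1]mulr1.
have inG (s : R) : 0 <= s <= 1 -> G (x, s * (t' - t) + t).
  move=> /andP[s0 s1]; rewrite GE; rewrite GE in G1 G2.
  move: G1 G2 => /cubeP[G1x /= G1t] /cubeP[_ /= G2t]; apply/cubeP; split=> //=.
  move: G1t G2t; rewrite !ltr_norml => /andP[a1 a2] /andP[b1 b2].
  have : 0 <= s * (t' - t) by rewrite mulr_ge0 // subr_ge0.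
  have : s * (t' - t) <= t' - t by rewrite ler_piMl // subr_ge0.
  by move=> h1 h2; apply/andP; split; lra.
have [s s01|s s01] := @MVT_line R S D (x, t) ((t' - t) *: direction R None)
   (fun z => (t' - t) * DP None z).
  rewrite E; apply: is_derive_scale_dir.
  by have [_ d _ _ _] := J (inG s s01); exact: (d None).
have := E 1; rewrite scale1r mul1r subrK => ->.
rewrite E => ->.
have s01' : 0 <= s <= 1 by case/andP: s01 => /ltW -> /ltW ->.
have /andP[h1 h2] := DPG (inG s s01').
have tt : 0 <= t' - t by rewrite subr_ge0.
by apply/andP; split; [rewrite [leLHS]mulrC|rewrite [leRHS]mulrC]; rewrite ler_wpM2l.
Qed.

(** At the time of [xi0], [D] lies below a negative quadratic, and it increases in time at a rate
    between [th / 2] and [2 * th]. On a box short in time compared with its squared width, [D] is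
    thus negative on the bottom by the growth in time and on the sides by the decay in space. *)
Lemma quadratic_touching : exists (a b : 'rV[R]_n) (t1 t2 gap : R),
  [/\ (forall i, a 0 i < b 0 i) /\ t1 < t2, 0 < gap,
    closure (spacetime_box a b t1 t2) `<=` G, spacetime_box a b t1 t2 xi0
    & forall xi, parabolic_boundary a b t1 t2 xi -> G xi /\ D xi <= - gap].
Proof.
pose d := r / 2; have d0 : 0 < d by rewrite divr_gt0.
(* The growth of [D] over a time [tau] is at most half of the spatial drop [eta / 4 * d ^+ 2]
   reached on the sides. *)
pose tau := Num.min d (eta * d ^+ 2 / (16 * th)).
have tau0 : 0 < tau.
  by rewrite lt_min d0 /= divr_gt0 // mulr_gt0 // exprn_gt0.
have taud : tau <= d by rewrite ge_min lexx.
have tauth : 2 * th * tau <= eta * d ^+ 2 / 8.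
  have : tau <= eta * d ^+ 2 / (16 * th) by rewrite ge_min lexx orbT.
  rewrite ler_pdivlMr ?mulr_gt0 //; lra.
(* The two terms are the margins left on the sides and on the bottom. *)
pose gap := Num.min (eta * d ^+ 2 / 8) (th * tau / 2).
have gap0 : 0 < gap.
  by rewrite lt_min !divr_gt0 // mulr_gt0 // exprn_gt0.
have gap1 : gap <= eta * d ^+ 2 / 8 by rewrite ge_min lexx.
have gap2 : gap <= th * tau / 2 by rewrite ge_min lexx orbT.
exists (shift_vec xi0.1 (- d)), (shift_vec xi0.1 d), (xi0.2 - tau), (xi0.2 + tau), gap.
have dr : d < r by rewrite /d ltr_pdivrMr // ltr_pMr // ltr1n.
clearbody gap tau d.
have inG x t : closed_box (shift_vec xi0.1 (- d)) (shift_vec xi0.1 d) x ->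
    xi0.2 - tau <= t <= xi0.2 + tau -> G (x, t).
  move=> bx /andP[t1 t2]; rewrite GE; apply/cubeP; split=> [i|] /=.
    have := bx i; rewrite in_itv /= !mxE => /andP[h1 h2].
    by rewrite ltr_norml; apply/andP; split; lra.
  by rewrite ltr_norml; apply/andP; split; lra.
split => //.
- by split=> [i|]; [rewrite !mxE; lra|lra].
- by move=> [x t] /closure_spacetime_box_sub[/= bx]; rewrite in_itv; exact: inG.
- split=> /=; last by apply/andP; split; lra.
  by move=> i; rewrite !mxE; apply/andP; split; lra.
move=> [x t] /parabolic_boundaryP[]; first by lra.
move=> /= bx tt bd.
have Gt := inG _ _ bx tt; split=> //; have /andP[tt1 tt2] := tt.
have G0 : G (x, xi0.2) by apply: inG => //; apply/andP; split; lra.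
have Dx := space_bound G0.
case: bd => [tE|[i xE]].
  have : t <= xi0.2 by rewrite tE; lra.
  move=> /(time_bound Gt G0)/andP[+ _]; rewrite tE.
  have : 0 <= eta / 4 * sqnorm (x - xi0.1) by rewrite mulr_ge0 ?sqnorm_ge0 // ltW //
    divr_gt0.
  lra.
have sq : d ^+ 2 <= sqnorm (x - xi0.1).
  apply: le_trans (sqnorm_coord_le _ i); rewrite !mxE.
  by case: xE => ->; rewrite !mxE addrC addKr ?sqrrN.
have : eta / 4 * d ^+ 2 <= eta / 4 * sqnorm (x - xi0.1) by rewrite ler_wpM2l // ltW //
  divr_gt0.
have [xt|/ltW xt] := leP t xi0.2.
  have /andP[+ _] := time_bound Gt G0 xt.
  have : 0 <= th / 2 * (xi0.2 - t) by rewrite mulr_ge0 ?subr_ge0 // ltW // divr_gt0.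
  lra.
have /andP[_] := time_bound G0 Gt xt.
have : 2 * th * (t - xi0.2) <= 2 * th * tau by apply: ler_wpM2l; [rewrite mulr_ge0 //
  ltW|rewrite lerBlDl].
lra.
Qed.

End QuadraticTouching.

End Touching.

(** * Comparison with superparabolic functions *)

Section Comparison.
Context {R : realType} {n : nat}.
Local Notation S := (spacetime R n).
Implicit Types (phi psi : S -> R) (xi : S) (O : set S) (x y : 'rV[R]_n).

(** If the inequality failed, [D = h - v] for a suitable caloric polynomial [h] would satisfy the
    hypotheses of [quadratic_touching]. Then [h + gap <= v <= u] on the parabolic boundary of a box,
    while [h + gap] exceeds [u] at [xi0]. *)
Lemma superparabolic_touching p (Theta O : set S) (u : S -> \bar R) v F1 F11 Ft xi0 :
  (0 < n)%N -> 1 < p -> superparabolic p Theta u ->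
  open O -> O `<=` Theta -> O xi0 -> radial2 O 0 v F1 F11 Ft -> F1 xi0 != 0 ->
  u xi0 = (v xi0)%:E -> (forall xi, O xi -> ((v xi)%:E <= u xi)%E) ->
  2 * (n%:R + p - 2) * F1 xi0 + 4 * (p - 1) * sqnorm xi0.1 * F11 xi0 <= Ft xi0.
Proof.
move=> n0 p1 [_ _ _ spu] oO OT Oxi0 rv F10 uv0 vu.
set N := n%:R + p - 2; set K := p - 1.
set x0 := xi0.1; set t0 := xi0.2; set sg := sqnorm x0.
set f1 := F1 xi0 in F10 *; set f11 := F11 xi0; set ft := Ft xi0.
rewrite leNgt; apply/negP => strict.
have N0 : 0 < N.
  have : (1 : R) <= n%:R by rewrite ler1n.
  by rewrite /N; lra.
pose th := 2 * N * f1 + 4 * K * sg * f11 - ft.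
have th0 : 0 < th by rewrite subr_gt0.
(* The first bound ensures [2 * f1 - eta != 0], the second that shrinking the Hessian by [eta] uses
   up at most half of the defect [th]. *)
pose eta := Num.min `|f1| (th / (2 * N)).
have eta0 : 0 < eta by rewrite lt_min normr_gt0 F10 /= divr_gt0 // mulr_gt0.
have etaf1 : eta <= `|f1| by rewrite ge_min lexx.
have etaN : N * eta <= th / 2.
  have : eta <= th / (2 * N) by rewrite ge_min lexx orbT.
  rewrite ler_pdivlMr ?mulr_gt0 //; lra.
clearbody eta.
(* The caloric polynomial [h] is radial about [y]. [B], [k] and [gamma] are
   determined by [B * k = 2 * f1] (equal gradients) and
   [8 * gamma * k ^+ 2 = 4 * f11], so that the Hessians differ by [- eta%:M]. *)
pose B := 2 * f1 - eta.
have B0 : B != 0.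
  apply: contraTneq F10 => /eqP; rewrite subr_eq0 => /eqP f1E.
  have f1p : 0 < f1 by lra.
  by move: etaf1; rewrite gtr0_norm //; lra.
pose k := 2 * f1 / B.
have k0 : k != 0 by rewrite mulf_neq0 ?invr_eq0 // mulf_neq0 // pnatr_eq0.
have Bk : B * k = 2 * f1 by rewrite mulrC divfK.
pose gamma := f11 / (2 * k ^+ 2).
have gk : 8 * gamma * k ^+ 2 = 4 * f11 by rewrite /gamma; field.
pose y := (1 - k) *: x0.
have x0y : x0 - y = k *: x0 by rewrite /y scalerBl scale1r opprB addrC subrK.
pose s0 := k ^+ 2 * sg.
have s0E : sqnorm (x0 - y) = s0 by rewrite x0y sqnormZ.
pose beta := B / 2 - 2 * gamma * s0.
pose al := v xi0 - (beta * s0 + gamma * s0 ^+ 2).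
clearbody gamma k.
pose c1 := 4 * (N + 2 * K).
pose h (a : R) (xi : S) := a + (beta * (sqnorm (xi.1 - y) + 2 * N * (xi.2 - t0))
       + gamma * (sqnorm (xi.1 - y) ^+ 2 + c1 * sqnorm (xi.1 - y) * (xi.2 - t0)
                  + N * c1 * (xi.2 - t0) ^+ 2)).
pose H1 (xi : S) := beta + gamma * (2 * sqnorm (xi.1 - y) + c1 * (xi.2 - t0)).
pose Ht (xi : S) := 2 * N * H1 xi + 4 * K * sqnorm (xi.1 - y) * (2 * gamma).
have rh a : radial2 [set: S] y (h a) H1 (fun=> 2 * gamma) Ht.
  exact: caloric_polynomial.
have h0 : h al xi0 = v xi0.
  by rewrite /h -/x0 -/t0 s0E subrr /al; ring.
have H10 : H1 xi0 = B / 2.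
  by rewrite /H1 -/x0 -/t0 s0E subrr /beta; ring.
have Ht0 : Ht xi0 = 2 * N * f1 - N * eta + 4 * K * sg * f11.
  have : 4 * K * s0 * (2 * gamma) = K * sg * (8 * gamma * k ^+ 2) by rewrite /s0; ring.
  by rewrite /Ht H10 -/x0 s0E => ->; rewrite gk /B; field.
(* This excess of the time derivative is [th - N * eta], at least [th / 2]. *)
pose th' := Ht xi0 - ft.
have th'0 : 0 < th' by rewrite /th' Ht0; move: etaN; rewrite /th in th0 *; lra.
have [P [PP [J HJ]]] := rh al; have [P' [PP' [J' HJ']]] := rv.
have JD := jet2D (jet2_subset (@subsetT _ O) J) (jet2Z (-1) J').
set D := (X in jet2 O X) in JD.
set DP := (X in jet2 O _ X) in JD.
set DPP := (X in jet2 O _ _ X) in JD.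
have [PS PN PPS] := HJ xi0 I; have [PS' PN' PPS'] := HJ' xi0 Oxi0.
have zE i : xi0.1 0 i - y 0 i = k * x0 0 i.
  by have /rowP/(_ i) := x0y; rewrite !mxE.
have DP0 i : DP (Some i) xi0 = 0.
  rewrite /DP PS PS' H10 -/f1 zE -/x0 !mxE subr0.
  rewrite (_ : 2 * (B / 2) * (k * x0 0 i) = B * k * x0 0 i); last by field.
  by rewrite Bk; ring.
have DPN : DP None xi0 = th' by rewrite /DP PN PN' /th' -/ft; ring.
have DPPS (i j : 'I_n) : DPP (Some i) (Some j) xi0 = - eta * (i == j)%:R.
  rewrite /DPP PPS PPS' H10 -/f1 -/f11 !zE -/x0 !mxE !subr0.
  rewrite (_ : 4 * (2 * gamma) * (k * x0 0 i) * (k * x0 0 j) = 8 * gamma * k ^+ 2 * x0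
    0 i * x0 0 j); last by ring.
  by rewrite gk /B; field.
have D0 : D xi0 = 0 by rewrite /D h0; ring.
have cH1 : {for xi0, continuous H1}.
  have s := radial2_sqnorm [set: S] y.
  have t := radial2D (radial2_time [set: S] y) (radial2_cst [set: S] y (- t0)).
  exact: (radial2_continuous (radial2D (radial2_cst [set: S] y beta)
    (radial2Z gamma (radial2D (radial2Z 2 s) (radial2Z c1 t)))) (I : [set: S] xi0)).
have nR : 0 < n%:R :> R by rewrite ltr0n.
have [_ _ cDP _ cDPP] := JD _ Oxi0.
(* Near [xi0] continuity preserves the estimates on [D], and [H1 != 0], which makes the polynomial a
   viscosity solution by [radial_solution]. *)
have good : nbhs xi0 [set z | [/\ O z, H1 z != 0, th' / 2 < DP None z < 2 * th' &
    forall ij : 'I_n * 'I_n, `|DPP (Some ij.1) (Some ij.2) z + eta * (ij.1 == ij.2)%:R|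
      <= eta / (2 * n%:R)]].
  have n1 : nbhs xi0 O by exact: open_nbhs_nbhs.
  have n2 : nbhs xi0 [set z | H1 z != 0].
    have H1n : H1 xi0 != 0 by rewrite H10 mulf_neq0 // invr_eq0 pnatr_eq0.
    exact: (cvgr_neq0 _ cH1 H1n).
  have n3 : nbhs xi0 [set z | th' / 2 < DP None z].
    by apply: (cvgr_gt _ (cDP None)); rewrite DPN; lra.
  have n4 : nbhs xi0 [set z | DP None z < 2 * th'].
    by apply: (cvgr_lt _ (cDP None)); rewrite DPN; lra.
  have n5 : nbhs xi0 [set z | forall ij : 'I_n * 'I_n, `|DPP (Some ij.1) (Some ij.2) z
    + eta * (ij.1 == ij.2)%:R| <= eta / (2 * n%:R)].
    have := @filter_forall S ('I_n * 'I_n)%type (fun ij => [set z | `|DPP (Some ij.1)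
      (Some ij.2) z + eta * (ij.1 == ij.2)%:R| <= eta / (2 * n%:R)]) (nbhs xi0)
      (nbhs_filter xi0).
    apply=> -[i j] /=; have /cvgrPdist_le := cDPP (Some i) (Some j).
    rewrite DPPS => /(_ (eta / (2 * n%:R))) H.
    have e0 : 0 < eta / (2 * n%:R) by rewrite divr_gt0 // mulr_gt0.
    apply: (@filterS _ (nbhs xi0) (nbhs_filter xi0) _ _ _ (H e0)) => z /=.
    by rewrite -normrN opprB mulNr opprK.
  apply: (@filterS _ (nbhs xi0) (nbhs_filter xi0) _ _ _ (filterI (filterI n1 n2)
    (filterI (filterI n3 n4) n5))).
  by move=> z [[? ?] [[? ?] ?]]; split=> //; apply/andP; split.
have [r r0 Hr] := nbhs_cube good.
have GO : cube xi0 r `<=` O by move=> z /Hr[].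
have [||a [b [t1 [t2 [gap [[ab t12] gap0 QG Qxi0 Dgap]]]]]] :=
   @quadratic_touching R n (cube xi0 r) D DP DPP xi0 r eta th' n0 r0 eta0 th'0 erefl
     (jet2_subset GO JD) D0 DP0.
- by move=> z /Hr[_ _ _ H] i j; exact: (H (i, j)).
- by move=> z /Hr[_ _ /andP[h1 h2] _]; rewrite (ltW h1) (ltW h2).
have QH1 z : spacetime_box a b t1 t2 z -> H1 z != 0.
  by move=> /subset_closure/QG/Hr[].
have ch : {within closure (spacetime_box a b t1 t2), continuous (h (al + gap))}.
  by apply: continuous_subspaceT => z; exact: (radial2_continuous (rh _) (I : [set: S]
    z)).
have hE z : h (al + gap) z = D z + gap + v z by rewrite /D /h; ring.
suff : ((h (al + gap) xi0)%:E <= u xi0)%E.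
  by rewrite uv0 lee_fin hE D0; lra.
apply: (spu a b t1 t2 ab t12 (@compact_closure_spacetime_box _ _ a b t1 t2)
  (subset_trans QG (subset_trans GO OT)) (h (al + gap)) ch) => //.
  apply: (radial_solution n0 p1 (@open_spacetime_box _ _ a b t1 t2) (radial2_subset
    (@subsetT _ _) (rh (al + gap)))) => // z.
move=> z /Dgap[Gz Dz]; apply: le_trans (vu z (GO z Gz)).
by rewrite lee_fin hE; lra.
Qed.

(** Compactness makes local upper bounds uniform. This bounds [w]; and were the supremum not
    attained, it would give an upper bound strictly below the supremum. *)
Lemma compact_usc_max (T : topologicalType) (A : set T) (w : T -> R) :
  A !=set0 -> compact A ->
  (forall z b, A z -> w z < b -> \forall z' \near z, A z' -> w z' < b) ->
  exists2 z, A z & forall z', A z' -> w z' <= w z.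
Proof.
move=> [a Aa] /compact_near_coveringP cA usc.
have ub : has_ubound (w @` A).
  have H z : A z -> \forall z' \near z & c \near +oo, A z' -> w z' < c.
    move=> Az; exists ([set z' | A z' -> w z' < w z + 1], [set c | w z + 1 < c]).
      split=> /=; last by apply: nbhs_pinfty_gt; exact: num_real.
      by apply: usc => //; rewrite ltrDl.
    by move=> [z' c] /= [h1 h2] /h1 h3; exact: lt_trans h3 h2.
  have C : \forall c \near +oo, A `<=` (fun z => A z -> w z < c) by exact: (cA R).
  have [c Hc] := filter_ex C.
  by exists c => _ [z Az <-]; apply: ltW; exact: Hc.
have hs : has_sup (w @` A) by split=> //; exists (w a); exists a.
apply: contrapT => nmax.
have lts z : A z -> w z < sup (w @` A).
  move=> Az; rewrite lt_neqAle; apply/andP; split; last first.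
    by apply: ub_le_sup => //; exists z.
  apply/eqP => wz; apply: nmax; exists z => // z' Az'.
  by rewrite wz; apply: ub_le_sup => //; exists z'.
pose s := sup (w @` A).
have H z : A z -> \forall z' \near z & c \near s^'-, A z' -> w z' < c.
  move=> Az; have ws : w z < s := lts _ Az.
  exists ([set z' | A z' -> w z' < (w z + s) / 2], [set c | (w z + s) / 2 < c]).
    split=> /=; last by apply: nbhs_left_gt; lra.
    by apply: usc => //; lra.
  by move=> [z' c] /= [h1 h2] /h1 h3; exact: lt_trans h3 h2.
have nc : \forall c \near s^'-, A `<=` (fun z => A z -> w z < c) by exact: (cA R).
have ns : \forall c \near s^'-, c < s by exact: nbhs_left_lt.
have [c [Hc cs]] := filter_ex (filterI nc ns).
suff : s <= c by rewrite leNgt cs.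
apply: ge_sup; first by exists (w a); exists a.
by move=> _ [z Az <-]; apply: ltW; exact: Hc.
Qed.

Lemma comparison_below p (Theta : set S) (u : S -> \bar R) v F1 F11 Ft :
  (0 < n)%N -> 1 < p -> open Theta -> compact (closure Theta) ->
  (forall xi, Theta xi -> xi.2 < 0) ->
  superparabolic p Theta u -> radial2 Theta 0 v F1 F11 Ft ->
  (forall xi, Theta xi -> F1 xi != 0) ->
  (forall xi, Theta xi -> Ft xi <= 2 * (n%:R + p - 2) * F1 xi
     + 4 * (p - 1) * sqnorm xi.1 * F11 xi) ->
  (forall zeta, boundary Theta zeta -> zeta.2 < 0 ->
     \forall xi \near zeta, Theta xi -> ((v xi)%:E <= u xi)%E) ->
  forall xi, Theta xi -> ((v xi)%:E <= u xi)%E.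
Proof.
move=> n0 p1 oT cT Tneg spu rv F10 Feq bd xis Txis.
rewrite leNgt; apply/negP => us.
(* [T] lies between the time of the violation and 0, so boundary points at time 0, where nothing is
   assumed, are cut off. *)
pose T := xis.2 / 2.
have xs0 := Tneg _ Txis.
have T0 : T < 0 by rewrite /T; lra.
have xsT : xis.2 < T by rewrite /T; lra.
clearbody T.
have [uNy lscu _ _] := spu.
pose viol z := Theta z /\ (u z < (v z)%:E)%E.
(* [(T - t) * (v - u)^+], extended by 0; it is upper semicontinuous. *)
pose w z := if `[< viol z >] then (T - z.2) * (v z - fine (u z)) else 0.
have ufin z : viol z -> u z = (fine (u z))%:E.
  by move=> [Tz uz]; rewrite fineK // fin_real // uNy //= (lt_trans uz) // ltry.
pose A := closure Theta `&` [set z : S | z.2 <= T].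
have cA : compact A.
  apply: (subclosed_compact _ cT); last by move=> z [].
  apply: closedI; first exact: closed_closure.
  apply: (@closed_comp S R (fun z => z.2) [set t | t <= T]); last exact: closed_le.
  by move=> z _; exact: cvg_snd.
have A0 : A !=set0 by exists xis; split; [exact: subset_closure|rewrite /= ltW].
have w0 z : z.2 <= T -> 0 <= w z.
  move=> zT; rewrite /w; case: asboolP => // /[dup] vz [Tz].
  by rewrite (ufin _ vz) lte_fin => uv; rewrite mulr_ge0 // subr_ge0 // ltW.
have usc z b : A z -> w z < b -> \forall z' \near z, A z' -> w z' < b.
  move=> [cz zT] wb; have b0 : 0 < b := le_lt_trans (w0 z zT) wb.
  (* Near a boundary point with time at most [T < 0], [bd] excludes violations, so [w] vanishes
     there. *)
  have [Tz|nTz] := pselect (Theta z); last first.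
    have bz : boundary Theta z by split=> // /interior_subset.
    have := bd _ bz (le_lt_trans zT T0); apply: filterS => z' vu _.
    rewrite /w; case: asboolP => // -[Tz']; rewrite ltNge => /negP[]; exact: vu.
  (* [m] is the minimum of [u z] and [v z], finite even where [u z] is infinite. *)
  pose m := if `[< viol z >] then fine (u z) else v z.
  have mu : (m%:E <= u z)%E.
    rewrite /m; case: asboolP => [/ufin <- //|nv].
    by rewrite leNgt; apply/negP => uv; apply: nv.
  have wE : w z = (T - z.2) * (v z - m).
    by rewrite /w /m; case: asboolP => // _; rewrite subrr mulr0.
  have C0 : 0 < T - z.2 + 1 by rewrite ltr_wpDl // subr_ge0.
  (* Lowering [m] by [e] raises [w z] by less than [b - w z]; the added 1 keeps the denominator
     positive when [z.2 = T]. *)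
  pose e := (b - w z) / (2 * (T - z.2 + 1)).
  have e0 : 0 < e by rewrite divr_gt0 ?subr_gt0 // mulr_gt0.
  have eC : e * (T - z.2 + 1) = (b - w z) / 2 by rewrite /e; field; exact: lt0r_neq0.
  have me : ((m - e)%:E < u z)%E by apply: lt_le_trans mu; rewrite lte_fin ltrBlDr ltrDl.
  have n1 : nbhs z [set z' | Theta z' -> ((m - e)%:E < u z')%E].
    have [V nV HV] := lscu z (m - e) me.
    have nV' : within Theta (nbhs z) V by rewrite (nbhs_subspace_in Tz); exact: nV.
    by apply: (@filterS _ (nbhs z) (nbhs_filter z) _ _ _ nV') => z' VT Tz'; exact: HV
      (VT Tz').
  have n2 : nbhs z [set z' : S | (T - z'.2) * (v z' - (m - e)) < b].
    have cv := radial2_continuous rv Tz.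
    have ct : {for z, continuous (fun z' : S => T - z'.2)}.
      by apply: continuousB; [exact: cvg_cst|exact: cvg_snd].
    have cvm : {for z, continuous (fun z' : S => v z' - (m - e))}.
      by apply: continuousB; [exact: cv|exact: cvg_cst].
    apply: (cvgr_lt _ (continuousM ct cvm)).
    rewrite /=; move: wE eC wb e0; lra.
  apply: (@filterS _ (nbhs z) (nbhs_filter z) _ _ _ (filterI n1 n2)) => z' [/= h1 h2]
    [_ /= z'T].
  rewrite /w; case: asboolP => // /[dup] vz' [Tz' _].
  have := h1 Tz'; rewrite (ufin _ vz') lte_fin => h3.
  apply: le_lt_trans h2; rewrite ler_wpM2l ?subr_ge0 //; lra.
have [xi0 [c0 t0T] wmax] := compact_usc_max A0 cA usc.
have wpos : 0 < w xi0.
  have vs : viol xis by [].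
  apply: lt_le_trans (wmax xis _); last by split; [exact: subset_closure|rewrite /= ltW].
  rewrite /w; case: asboolP => // _; rewrite mulr_gt0 ?subr_gt0 //.
  by rewrite -lte_fin -ufin.
have v0 : viol xi0 by move: wpos; rewrite /w; case: asboolP => //; rewrite ltxx.
have T0x : xi0.2 < T.
  rewrite lt_neqAle; apply/andP; split=> //; apply/eqP => tE.
  by move: wpos; rewrite /w tE subrr mul0r if_same ltxx.
pose M := w xi0.
pose O := Theta `&` [set z : S | z.2 < T].
have oO : open O.
  apply: openI => //; apply: (@open_comp S R (fun z => z.2) [set t | t < T]); last
    exact: open_lt.
  by move=> z _; exact: cvg_snd.
have OT : O `<=` Theta by move=> z [].
have tO z : O z -> z.2 < T by case.
have rO := radial2D (radial2_subset OT rv) (radial2_pole 0 (- M) tO).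
have Tx := v0.1.
have Oxi0 : O xi0 by split.
(* The function [v - M / (T - t)] touches [u] from below at [xi0], and its pole lowers the time
   derivative strictly, against [Feq]. *)
have := superparabolic_touching n0 p1 spu oO OT Oxi0 rO.
rewrite addr0 => /(_ (F10 _ Tx)) H.
have : 0 < M / (T - xi0.2) ^+ 2 by rewrite divr_gt0 // exprn_gt0 // subr_gt0.
have := Feq _ Tx.
suff : 2 * (n%:R + p - 2) * F1 xi0 + 4 * (p - 1) * sqnorm xi0.1 * (F11 xi0 + 0) <=
       Ft xi0 + - M / (T - xi0.2) ^+ 2 by lra.
apply: H => [|z [Tz zT]].
  rewrite (ufin _ v0) /M /w; case: asboolP => // _; congr EFin; field.
  by rewrite subr_eq0 gt_eqF.
have q0 : 0 <= M / (T - z.2) by rewrite divr_ge0 ?subr_ge0 // ltW.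
have [uv|] := boolP (u z < (v z)%:E)%E; last first.
  by rewrite -leNgt => vu; apply: le_trans vu; rewrite lee_fin mulNr gerBl.
have vz : viol z by split.
rewrite (ufin _ vz) lee_fin mulNr.
have : w z <= M by apply: wmax; split; [exact: subset_closure|rewrite /= ltW].
rewrite /w; case: asboolP => // _; rewrite mulrC -ler_pdivlMr ?subr_gt0 //; lra.
Qed.

End Comparison.

(** * Barriers in the Petrovsky domain *)

Section Barriers.
Context {R : realType} {n : nat}.
Local Notation S := (spacetime R n).
Implicit Types (phi psi : S -> R) (xi : S) (O : set S) (x y : 'rV[R]_n).

Definition tau (xi : S) : R := - ln (- xi.2).

(** This is [tau^(-m) exp(kappa |x|^2 / s)] with [s = -t], as a single exponential so that
    [radial2_expR] differentiates it. *)
Definition gaussian (kappa m : R) (xi : S) : R :=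
  expR (kappa * sqnorm xi.1 / - xi.2 - m * ln (tau xi)).

(** [g2] is an exponent: the second term is [g1 tau^(-g2)]. *)
Definition barrier (g0 g1 g2 theta kappa m : R) (xi : S) : R :=
  g0 + (g1 * expR (- g2 * ln (tau xi)) + theta * gaussian kappa m xi).

Lemma tau_gt0 xi : -1 < xi.2 < 0 -> 0 < tau xi.
Proof. by move=> /andP[h1 h2]; rewrite oppr_gt0 ln_lt0 // oppr_gt0 h2 /=; lra. Qed.

Lemma radial2_barrier O g0 g1 g2 theta kappa m :
  (forall xi, O xi -> -1 < xi.2 < 0) ->
  radial2 O 0 (barrier g0 g1 g2 theta kappa m)
    (fun xi => theta * (gaussian kappa m xi * (kappa / - xi.2)))
    (fun xi => theta * (gaussian kappa m xi * (kappa / - xi.2) ^+ 2))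
    (fun xi => g1 * (expR (- g2 * ln (tau xi)) * (- g2 / (- xi.2 * tau xi)))
       + theta * (gaussian kappa m xi * (kappa * sqnorm xi.1 / xi.2 ^+ 2 - m / (- xi.2
         * tau xi)))).
Proof.
move=> O0.
have s0 xi : O xi -> 0 < - xi.2 by move=> /O0/andP[_]; rewrite oppr_gt0.
have t0 xi : O xi -> 0 < tau xi by move=> /O0/tau_gt0.
have rs := radial2N (radial2_time O 0).
have rt := radial2N (radial2_ln rs s0).
have rl := radial2_ln rt t0.
have rV := radial2V rs (fun xi Oxi => lt0r_neq0 (s0 xi Oxi)).
have rq := radial2M (radial2Z kappa (radial2_sqnorm O 0)) rV.
have rE := radial2_expR (radial2D rq (radial2N (radial2Z m rl))).
have rG := radial2_expR (radial2Z (- g2) rl).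
apply: radial2_ext (radial2D (radial2_cst O 0 g0) (radial2D (radial2Z g1 rG) (radial2Z
  theta rE))) _ _.
  by move=> xi; rewrite /barrier /gaussian /tau subr0.
move=> xi Oxi; have := t0 _ Oxi; have := s0 _ Oxi; rewrite oppr_gt0 => /ltr0_neq0 h1
  /lt0r_neq0 h2.
rewrite /gaussian /tau in h2 *; rewrite subr0.
have h3 : ln (- xi.2) != 0 by rewrite -oppr_eq0.
by split; field; rewrite ?h1 ?h3.
Qed.

Lemma expR_ln_tau_small (c eps : R) : 0 < c -> 0 < eps ->
  exists2 s0 : R, 0 < s0 & forall s, 0 < s -> s < s0 -> expR (- c * ln (- ln s)) < eps.
Proof.
(* With [tau = - ln s], the threshold solves [tau^(-c) = eps], that is [tau = eps^(-1/c)]. *)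
move=> c0 e0; exists (expR (- expR (- ln eps / c))); first exact: expR_gt0.
move=> s sp ss; rewrite -[eps]lnK // ltr_expR.
have : expR (- ln eps / c) < - ln s.
  by rewrite ltrNr -ltr_expR lnK.
have : 0 < expR (- ln eps / c) by exact: expR_gt0.
move=> h1 h2; have h3 := lt_trans h1 h2.
move: h2; rewrite -[- ln s in X in X -> _]lnK // ltr_expR ltr_pdivrMr //; lra.
Qed.

End Barriers.

(** * Geometry of the Petrovsky domain *)

Section Domain.
Context {R : realType} {n : nat}.
Variable A : R.
Hypothesis A0 : 0 < A.
Local Notation S := (spacetime R n).
Local Notation Theta := (petrovsky_domain n A).
Implicit Types (xi zeta : S).

Lemma petrovskyP xi : Theta xi <->
  - (1 / 3) < xi.2 < 0 /\ sqnorm xi.1 < A * - xi.2 * ln (tau xi).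
Proof.
have E : - (1 / 3) < xi.2 < 0 -> A * `|xi.2| * ln `|ln `|xi.2| | = A * - xi.2 * ln (tau
  xi).
  move=> /andP[h1 h2]; rewrite (ltr0_norm h2) (_ : `|ln (- xi.2)| = tau xi) //.
  by rewrite ler0_norm // ltW // ln_lt0 // oppr_gt0 h2 /=; lra.
by split=> [[h1 h2]|[h1 h2]]; split=> //; rewrite ?E // -E.
Qed.

Lemma petrovsky_time xi : Theta xi -> -1 < xi.2 < 0.
Proof. by move=> [_ /andP[h1 h2]]; rewrite h2 andbT; lra. Qed.

(** Positivity of [ln (tau xi)] is read off from the defining inequality of the domain, whose left
    side is nonnegative. *)
Lemma petrovsky_tau xi : Theta xi -> 0 < ln (tau xi) /\ 1 < tau xi.
Proof.
move=> Txi; have t0 := tau_gt0 (petrovsky_time Txi).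
have /petrovskyP[/andP[_ h2] h] := Txi.
have : 0 < ln (tau xi).
  by have := le_lt_trans (sqnorm_ge0 xi.1) h; rewrite pmulr_rgt0 // mulr_gt0 // oppr_gt0.
by move=> l0; split=> //; rewrite -ltr_ln ?posrE // ln1.
Qed.

(** The iterated logarithm enters here: inside the domain [|x|^2 / s < A ln tau], so the exponential
    is bounded by the power [tau^(kappa A)]. *)
Lemma petrovsky_gaussian kappa m xi : 0 < kappa -> Theta xi ->
  gaussian kappa m xi < expR ((kappa * A - m) * ln (tau xi)).
Proof.
move=> k0 /petrovskyP[/andP[_ h2] h]; rewrite ltr_expR mulrBl ltrD2r.
rewrite -mulrA -mulrA ltr_pM2l // ltr_pdivrMr ?oppr_gt0 //; lra.
Qed.

Lemma open_petrovsky : open Theta.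
Proof.
pose O1 : set S := [set z | - (1 / 3) < z.2 < 0].
have oO1 : open O1.
  rewrite (_ : O1 = snd @^-1` `](- (1 / 3)), 0[%classic).
    by apply: open_comp; [move=> z _; exact: cvg_snd|exact: itv_open].
  by apply/seteqP; split=> z /=; rewrite in_itv.
rewrite openE => xi Txi; have [xiO1 _] := (petrovskyP xi).1 Txi.
have O0 z : O1 z -> -1 < z.2 < 0 by move=> /andP[h1 h2]; rewrite h2 andbT; lra.
have s0 z : O1 z -> 0 < - z.2 by move=> /O0/andP[_]; rewrite oppr_gt0.
have t0 z : O1 z -> 0 < tau z by move=> /O0/tau_gt0.
have rs := radial2N (radial2_time O1 0).
have rl := radial2_ln (radial2N (radial2_ln rs s0)) t0.
have cf := radial2_continuous (radial2D (radial2M (radial2Z A rs) rl) (radial2N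
  (radial2_sqnorm O1 0))) xiO1.
have fpos : 0 < A * - xi.2 * ln (tau xi) - sqnorm (xi.1 - 0).
  by rewrite subr0 subr_gt0; case/petrovskyP: Txi.
have n1 : nbhs xi [set z : S | 0 < A * - z.2 * ln (tau z) - sqnorm (z.1 - 0)].
  exact: cvgr_gt _ cf _ fpos.
have n2 : nbhs xi O1 by exact: open_nbhs_nbhs.
apply: (@filterS _ (nbhs xi) (nbhs_filter xi) _ _ _ (filterI n1 n2)) => z [/= h1 h2].
by apply/petrovskyP; split=> //; move: h1; rewrite subr0 subr_gt0.
Qed.

(** Applying [ln a < a] twice gives [ln tau <= tau <= 2 / sqrt s]. This cruder bound is continuous
    up to time 0, hence passes to the closure, and shows that the origin is the only boundary point
    at time 0. *)
Lemma petrovsky_sqnorm xi : Theta xi -> sqnorm xi.1 <= 2 * A * Num.sqrt (- xi.2).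
Proof.
move=> Txi; have [l0 t1] := petrovsky_tau Txi.
have /petrovskyP[/andP[_ h2] h] := Txi.
have s0 : 0 < - xi.2 by rewrite oppr_gt0.
apply: le_trans (ltW h) _; set r := Num.sqrt (- xi.2).
have r0 : 0 < r by rewrite sqrtr_gt0.
have rr : - xi.2 = r ^+ 2 by rewrite sqr_sqrtr // ltW.
have ltt : ln (tau xi) <= tau xi by apply: ltW; apply: ln_sublinear; exact: lt_trans t1.
have tau2 : tau xi <= 2 / r.
  rewrite /tau rr lnXn // (_ : - (ln r *+ 2) = 2 * - ln r); last by ring.
  rewrite ler_pM2l // -lnV ?posrE //.
  by apply: ltW; apply: ln_sublinear; rewrite invr_gt0.
have : r ^+ 2 * ln (tau xi) <= r ^+ 2 * (2 / r).
  by rewrite ler_wpM2l ?sqr_ge0 //; exact: le_trans tau2.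
rewrite rr (_ : r ^+ 2 * (2 / r) = 2 * r); last by field; exact: lt0r_neq0.
by rewrite -(ler_pM2l A0); lra.
Qed.

Lemma closure_petrovsky xi : closure Theta xi ->
  - (1 / 3) <= xi.2 <= 0 /\ sqnorm xi.1 <= 2 * A * Num.sqrt (- xi.2).
Proof.
move=> cl; split.
  have : closed (snd @^-1` `[(- (1 / 3)), 0]%classic : set S).
    by apply: closed_comp; [move=> z _; exact: cvg_snd|exact: itv_closed].
  move=> /(_ xi); rewrite /= in_itv; apply; apply: closure_subset cl => z [_ /andP[h1
    h2]].
  by rewrite /= in_itv /= !ltW.
have cf : continuous (fun z : S => sqnorm (z.1 - 0) - 2 * A * Num.sqrt (- z.2)).
  move=> z.
  have c1 : {for z, continuous (fun z : S => sqnorm (z.1 - 0))}.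
    exact: (radial2_continuous (radial2_sqnorm [set: S] 0) (I : [set: S] z)).
  have c2 : {for z, continuous (fun z : S => Num.sqrt (- z.2))}.
    apply: (@continuous_comp S R R (fun z => - z.2) Num.sqrt).
      by apply: continuousN; exact: cvg_snd.
    exact: sqrt_continuous.
  have c3 : {for z, continuous (fun z : S => 2 * A * Num.sqrt (- z.2))}.
    by apply: continuousM; [exact: cvg_cst|exact: c2].
  exact: (continuousB c1 c3).
have : closed ((fun z : S => sqnorm (z.1 - 0) - 2 * A * Num.sqrt (- z.2)) @^-1` [set r
  | r <= 0]).
  by apply: closed_comp; [move=> z _; exact: cf|exact: closed_le].
move=> /(_ xi) /=; rewrite subr0 subr_le0; apply; apply: closure_subset cl => z.
by move=> /petrovsky_sqnorm; rewrite /= subr0 subr_le0.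
Qed.

Lemma compact_closure_petrovsky : compact (closure Theta).
Proof.
pose a : 'rV[R]_n := const_mx (2 * A + 1).
have sub : closure Theta `<=` closed_box (- a) a `*` `[(- (1 / 3)), 0]%classic.
  move=> xi /closure_petrovsky[/andP[h1 h2] h]; split; last by rewrite /= in_itv /= h1.
  move=> i; rewrite in_itv /= !mxE -ler_norml.
  have s1 : Num.sqrt (- xi.2) <= 1.
    by rewrite -[leRHS]sqrtr1 ler_sqrt //; lra.
  have : xi.1 0 i ^+ 2 <= (2 * A + 1) ^+ 2.
    apply: le_trans (sqnorm_coord_le _ i) _; apply: le_trans h _.
    have : 2 * A * Num.sqrt (- xi.2) <= 2 * A by rewrite ger_pMr // mulr_gt0.
    have := sqr_ge0 (2 * A); rewrite sqrrD; have := A0; lra.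
  have a0 : 0 <= 2 * A + 1 by rewrite addr_ge0 // mulr_ge0 // ltW.
  by move=> H; rewrite -ler_sqr ?nnegrE // real_normK ?num_real.
apply: subclosed_compact sub; first exact: closed_closure.
by apply: compact_setX; [exact: compact_closed_box|exact: segment_compact].
Qed.

Lemma boundary_petrovsky zeta : boundary Theta zeta ->
  [/\ - (1 / 3) <= zeta.2 <= 0, sqnorm zeta.1 <= 2 * A * Num.sqrt (- zeta.2) & ~ Theta
    zeta].
Proof.
move=> [/closure_petrovsky[h1 h2] ni]; split=> // Tz; apply: ni.
by apply: open_nbhs_nbhs; split=> //; exact: open_petrovsky.
Qed.

Lemma compact_boundary_petrovsky : compact (boundary Theta).
Proof.
apply: subclosed_compact compact_closure_petrovsky _; last by move=> z [].
rewrite /boundary setDE; apply: closedI; first exact: closed_closure.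
by apply: open_closedC; exact: open_interior.
Qed.

Lemma petrovsky_axis (r : R) : 0 < r ->
  exists2 t : R, - r < t < 0 & Theta (0, t).
Proof.
(* The value [1 / 4] stays within the time range, and [expR (- 2)] makes [tau] at least 2, so that
   [ln tau > 0]. *)
move=> r0; pose s := Num.min (r / 2) (Num.min (1 / 4) (expR (- 2))).
have s0 : 0 < s by rewrite !lt_min !divr_gt0 // expR_gt0.
have sr : s <= r / 2 by rewrite ge_min lexx.
have s4 : s <= 1 / 4 by rewrite !ge_min lexx /= orbT.
have se : s <= expR (- 2) by rewrite !ge_min lexx /= !orbT.
exists (- s); first by apply/andP; split; lra.
apply/petrovskyP; split=> /=; first by apply/andP; split; lra.
have /eqP -> : sqnorm (0 : 'rV[R]_n) == 0 by rewrite sqnorm_eq0.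
rewrite /tau /= opprK mulr_gt0 ?mulr_gt0 // ln_gt0 //.
have : ln s <= - 2 by rewrite -ler_expR lnK.
lra.
Qed.

Lemma origin_boundary : boundary Theta (0, 0).
Proof.
split.
  move=> V /nbhs_cube[r r0 Hr]; have [t tr Tt] := petrovsky_axis r0.
  exists (0, t); split=> //; apply: Hr; apply/cubeP; split=> [i|] /=; rewrite ?subrr
    ?normr0 //.
  by rewrite subr0 ltr_norml; case/andP: tr => h1 h2; apply/andP; split; lra.
by move=> /interior_subset [_ /=]; rewrite ltxx andbF.
Qed.

End Domain.

(** * Perron solutions at the origin *)

Lemma le_limf_einf {R : realType} (T : topologicalType) (F : set_system T)
  (u : T -> \bar R) (a : \bar R) : Filter F ->
  (\forall z \near F, (a <= u z)%E) -> (a <= limf_einf u F)%E.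
Proof.
move=> FF Fa; rewrite limf_einfE; apply: ereal_sup_ge.
exists (ereal_inf (u @` [set z | (a <= u z)%E])); first by exists [set z | (a <= u z)%E].
by apply: le_ereal_inf_tmp => _ [z az <-].
Qed.

Lemma limf_einf_gt {R : realType} (T : topologicalType) (F : set_system T)
  (u : T -> \bar R) (a : \bar R) : Filter F ->
  (a < limf_einf u F)%E -> \forall z \near F, (a < u z)%E.
Proof.
move=> FF; rewrite limf_einfE => /ereal_sup_gt[_ [V FV <-] aV].
apply: filterS FV => z Vz; apply: lt_le_trans aV _; apply: ereal_inf_lbound.
by exists z.
Qed.

Section Regularity.
Context {R : realType} {n : nat}.
Variables (p A : R).
Hypotheses (n0 : (0 < n)%N) (p1 : 1 < p) (A0 : 0 < A).
Local Notation S := (spacetime R n).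
Local Notation Theta := (petrovsky_domain n A : set S).
Implicit Types (f : S -> R) (xi zeta : S).

(** The strict margin [a < f zeta] turns the lim inf condition on a competitor [u] into [v <= a < u]
    near [zeta], and [comparison_below] concludes. Nothing is asked of [v] at the origin, the
    boundary point at time 0. *)
Lemma upper_perron_ge f v F1 F11 Ft xi :
  radial2 Theta 0 v F1 F11 Ft -> (forall xi, Theta xi -> F1 xi != 0) ->
  (forall xi, Theta xi -> Ft xi <= 2 * (n%:R + p - 2) * F1 xi
     + 4 * (p - 1) * sqnorm xi.1 * F11 xi) ->
  (forall zeta, boundary Theta zeta -> zeta.2 < 0 -> exists2 a, a < f zeta &
     \forall xi \near zeta, Theta xi -> v xi <= a) ->
  Theta xi -> ((v xi)%:E <= upper_perron p Theta f xi)%E.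
Proof.
move=> rv F10 Feq vf Txi; apply: le_ereal_inf_tmp => _ [u [spu ub] <-].
have neg z : Theta z -> z.2 < 0 by case=> _ /andP[].
apply: (@comparison_below R n p Theta u v F1 F11 Ft n0 p1 (@open_petrovsky R n A)
  (@compact_closure_petrovsky R n A A0) neg spu rv F10 Feq _ xi Txi) => zeta bz zneg;
    have [a af va] := vf _ bz zneg.
have : (a%:E < limf_einf u (within Theta (nbhs zeta)))%E.
  by apply: lt_le_trans (ub _ bz); rewrite lte_fin.
move=> /limf_einf_gt ua.
apply: (@filterS _ (nbhs zeta) (nbhs_filter zeta) _ _ _ (filterI va ua)) => z [/= h1
  h2] Tz.
by apply: ltW; apply: le_lt_trans (h2 Tz); rewrite lee_fin; exact: h1.
Qed.

Lemma upper_perron_le f u xi : superparabolic p Theta u ->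
  (forall zeta, boundary Theta zeta -> \forall xi \near zeta, Theta xi -> ((f zeta)%:E
    <= u xi)%E) ->
  (upper_perron p Theta f xi <= u xi)%E.
Proof.
move=> spu ub; apply: ereal_inf_lbound; exists u => //; split=> // zeta bz.
by apply: le_limf_einf; exact: ub.
Qed.

(** * Regularity for [A <= 4 * (p - 1)] *)

Section Critical.
Hypothesis Acrit : A <= 4 * (p - 1).
Let kappa := (4 * (p - 1))^-1.
Let c := (n%:R + p - 2) * kappa.
Let K0 : 0 < p - 1. Proof. by rewrite subr_gt0. Qed.
Let kappa0 : 0 < kappa. Proof. by rewrite invr_gt0 mulr_gt0. Qed.
Let N0 : 0 < n%:R + p - 2.
Proof. by have h1 : (1 : R) <= n%:R; [rewrite ler1n|move: p1 h1; lra]. Qed.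
Let c0 : 0 < c. Proof. by rewrite mulr_gt0. Qed.
Let power xi := expR (- c * ln (tau xi)).

(** The hypothesis on [A] says [kappa * A <= 1], so the exponent [kappa * A - (1 + c)] is at most
    [- c]. *)
Let gaussian_le xi : Theta xi -> gaussian kappa (1 + c) xi <= power xi.
Proof.
move=> Txi; apply: le_trans (ltW (petrovsky_gaussian (1 + c) kappa0 Txi)) _.
have [l0 _] := petrovsky_tau A0 Txi.
rewrite ler_expR ler_pM2r //.
have : kappa * A <= 1 by rewrite mulrC ler_pdivrMr ?mulr_gt0 // mul1r.
lra.
Qed.

Let gaussian_ge xi : Theta xi -> power xi / tau xi <= gaussian kappa (1 + c) xi.
Proof.
move=> Txi; have [l0 t1] := petrovsky_tau A0 Txi.
have -> : power xi / tau xi = expR (- (1 + c) * ln (tau xi)).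
  rewrite /power (_ : - (1 + c) * ln (tau xi) = - c * ln (tau xi) - ln (tau xi)); last
    by ring.
  by rewrite expRD expRN lnK // posrE; lra.
rewrite ler_expR mulNr lerBrDr addNr.
have /andP[_ s0] := petrovsky_time Txi.
by apply: divr_ge0; [apply: mulr_ge0; [exact: ltW|exact: sqnorm_ge0]|rewrite oppr_ge0
  ltW].
Qed.

(** Since [4 * (p - 1) * kappa = 1], the terms in [|x|^2] cancel, and [c = (n%:R + p - 2) * kappa]
    lets the rest group into [E - power / tau >= 0] and a positive term. One identity serves both
    signs: [theta > 0] gives a subsolution and [theta < 0] a supersolution. *)
Let critical_equation theta xi : Theta xi ->
  exists2 q : R, 0 <= q &
    2 * (n%:R + p - 2) * (theta * (gaussian kappa (1 + c) xi * (kappa / - xi.2)))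
    + 4 * (p - 1) * sqnorm xi.1 * (theta * (gaussian kappa (1 + c) xi * (kappa / -
      xi.2) ^+ 2))
    - ((- 2 * theta) * (power xi * (- c / (- xi.2 * tau xi)))
       + theta * (gaussian kappa (1 + c) xi * (kappa * sqnorm xi.1 / xi.2 ^+ 2 - (1 +
         c) / (- xi.2 * tau xi))))
    = theta * q.
Proof.
move=> Txi; have [l0 t1] := petrovsky_tau A0 Txi.
have /andP[_ s0] := petrovsky_time Txi.
have E0 := gaussian_ge Txi.
set E := gaussian _ _ _ in E0 *.
have s1 : 0 < - xi.2 by rewrite oppr_gt0.
have tp : 0 < tau xi by apply: lt_trans t1.
exists (2 * c / - xi.2 * (E - power xi / tau xi) + E * (1 + c) / (- xi.2 * tau xi)).
  apply: addr_ge0; apply: mulr_ge0.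
  - by rewrite ltW // divr_gt0 // mulr_gt0.
  - by rewrite subr_ge0.
  - by rewrite mulr_ge0 ?expR_ge0 // addr_ge0 // ltW.
  - by rewrite ltW // invr_gt0 mulr_gt0.
rewrite /c /kappa; field.
by rewrite (ltr0_neq0 s0) (lt0r_neq0 tp) (lt0r_neq0 K0).
Qed.

Let F1_neq0 theta xi : theta != 0 -> Theta xi ->
  theta * (gaussian kappa (1 + c) xi * (kappa / - xi.2)) != 0.
Proof.
move=> t0 /petrovsky_time/andP[_ s0].
apply: mulf_neq0 => //; apply: mulf_neq0; first by rewrite gt_eqF // expR_gt0.
apply: mulf_neq0; first exact: lt0r_neq0 kappa0.
by rewrite invr_eq0 oppr_eq0 (ltr0_neq0 s0).
Qed.

(** Near the origin [f] is within [eps] of [f0]; at earlier boundary points [power] is bounded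
    below, so a large multiple of it dominates the oscillation of [f]. *)
Let perron_bounds f (eps : R) : {within boundary Theta, continuous f} -> 0 < eps ->
  exists2 C, 0 < C & forall xi, Theta xi ->
    ((f (0, 0) - eps - C * power xi)%:E <= upper_perron p Theta f xi <= (f (0, 0) + eps
      + C * power xi)%:E)%E.
Proof.
move=> cf e0; set f0 := f (0, 0).
have b0 := origin_boundary (n := n) A0.
have [Bf HBf] : exists Bf : R, forall zeta, boundary Theta zeta -> `|f zeta| <= Bf.
  have bn0 : boundary Theta !=set0 by exists (0, 0).
  have cb := @compact_boundary_petrovsky R n A A0.
  have [z1 _ H1] := compact_EVT_max bn0 cb cf.
  have [z2 _ H2] := compact_EVT_min bn0 cb cf.
  exists (`|f z1| + `|f z2|) => zeta bz.
  have /H1 h1 : zeta \in boundary Theta by rewrite inE.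
  have /H2 h2 : zeta \in boundary Theta by rewrite inE.
  by have := ler_norm (f z1); have := ler_normr (- f z2) (f z2); rewrite ler_norml;
    have := ler_norm (- f z2);
     rewrite normrN; have := normr_ge0 (f z1); have := normr_ge0 (f z2); move=> *;
       apply/andP; split; lra.
have Bf0 : 0 <= Bf by apply: le_trans (HBf _ b0).
have [t1 [t10 t1h] near0] : exists2 t1 : R, 0 < t1 /\ t1 <= 1 / 2 &
    forall zeta, boundary Theta zeta -> - t1 < zeta.2 -> `|f zeta - f0| < eps.
  have nf : nbhs ((0, 0) : S) [set zeta | boundary Theta zeta -> `|f zeta - f0| < eps].
    have /cvgrPdist_lt/(_ _ e0) := cf (0, 0).
    rewrite /= /nbhs /= -(@nbhs_subspace_in _ (boundary Theta)) // => H.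
    apply: (@filterS _ (nbhs _) (nbhs_filter _) _ _ _ H) => z Hz bz.
    by rewrite distrC; exact: Hz.
  have [r r0 Hr] := nbhs_cube nf.
  pose q := r ^+ 2 / (2 * A).
  have q0 : 0 < q by rewrite divr_gt0 ?exprn_gt0 // mulr_gt0.
  (* If [s < q ^+ 2], then [|x|^2 <= 2 A sqrt s < r^2], so a boundary point late in time is close to
     the origin in space too. *)
  exists (Num.min (1 / 2) (Num.min r (q ^+ 2))).
    by split; [rewrite !lt_min r0 exprn_gt0 // divr_gt0|rewrite ge_min lexx].
  move=> zeta bz; rewrite ltrNl !lt_min => /andP[_ /andP[zr zq]]; apply: Hr => //.
  have [/andP[_ zneg] zs _] := boundary_petrovsky A0 bz.
  apply/cubeP; split=> [i|] /=; rewrite ?mxE subr0; last by rewrite ler0_norm.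
  have sq : Num.sqrt (- zeta.2) < q.
    by rewrite -(ltr_pXn2r (n := 2)) ?nnegrE ?sqrtr_ge0 ?ltW // sqr_sqrtr ?oppr_ge0.
  rewrite -ltr_sqr ?nnegrE ?(ltW r0) // real_normK ?num_real //.
  apply: le_lt_trans (sqnorm_coord_le _ i) _; apply: le_lt_trans zs _.
  by rewrite mulrC -ltr_pdivlMr ?mulr_gt0.
(* Half the value of [power] at time [- t1 / 2]: points of the domain near a boundary point at time
   [- t1] may be slightly later, and the barriers retain half of [power]. *)
pose wmin := expR (- c * ln (- ln (t1 / 2))) / 2.
have wmin0 : 0 < wmin by rewrite divr_gt0 // expR_gt0.
have power_ge xi : Theta xi -> xi.2 < - (t1 / 2) -> 2 * wmin <= power xi.
  move=> Txi tx; have [l0 tau1] := petrovsky_tau A0 Txi.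
  rewrite /wmin mulrC divfK // ler_expR !mulNr lerN2 ler_pM2l //.
  have tau2 : tau xi <= - ln (t1 / 2).
    by rewrite lerN2 ler_ln ?posrE; [lra|rewrite divr_gt0|lra].
  by rewrite ler_ln ?posrE //; lra.
(* Then [C * wmin] exceeds any difference of two values of [f] on the boundary. *)
pose C := (2 * Bf + 1) / wmin.
have C0 : 0 < C by rewrite divr_gt0 // ltr_wpDl // mulr_ge0.
have CE : C * wmin = 2 * Bf + 1 by rewrite divfK // gt_eqF.
exists C => // xi Txi.
have near_early zeta : zeta.2 <= - t1 -> \forall z \near zeta, z.2 < - (t1 / 2).
  move=> zt; have cz : {for zeta, continuous (fun z : S => z.2)} by exact: cvg_snd.
  by apply: (cvgr_lt _ cz); lra.
apply/andP; split.
  (* Positive [theta] gives the lower barrier [f0 - eps - C * (power - E / 2)], with [E] the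
     Gaussian; it is at most [f0 - eps - C * power / 2] because [E <= power]. *)
  pose v : S -> R := barrier (f0 - eps) (- 2 * (C / 2)) c (C / 2) kappa (1 + c).
  have vE z : v z = f0 - eps - C * (power z - gaussian kappa (1 + c) z / 2).
    by rewrite /v /barrier -/(power z); field.
  have vle z : Theta z -> v z <= f0 - eps - C * (power z / 2).
    by move=> Tz; rewrite vE lerD2l lerN2 ler_pM2l //; have := gaussian_le Tz; lra.
  apply: (@le_trans _ _ (v xi)%:E).
    rewrite lee_fin vE lerD2l lerN2 ler_pM2l // gerBl.
    by rewrite divr_ge0 // expR_ge0.
  apply: (upper_perron_ge (radial2_barrier _ _ _ _ _ _ (@petrovsky_time R n A))) => //.
  - by move=> z Tz; apply: F1_neq0 => //; rewrite gt_eqF // divr_gt0.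
  - move=> z Tz; have [q q0 E] := critical_equation (C / 2) Tz.
    by rewrite -subr_ge0 E mulr_ge0 // ltW // divr_gt0.
  move=> zeta bz zneg; have [zt|zt] := ltP (- t1) zeta.2.
    exists (f0 - eps).
      by have := near0 _ bz zt; rewrite ltr_norml => /andP[]; lra.
    apply: (@filterE _ (nbhs zeta) (nbhs_filter zeta)) => z Tz; apply: le_trans (vle z
      Tz) _.
    by rewrite gerBl mulr_ge0 ?ltW // divr_gt0 // expR_gt0.
  exists (f zeta - eps); first by rewrite gtrBl.
  apply: (@filterS _ (nbhs zeta) (nbhs_filter zeta) _ _ _ (near_early _ zt)) => z zt2 Tz.
  apply: le_trans (vle z Tz) _.
  have : C * wmin <= C * (power z / 2).
    by rewrite ler_pM2l //; have := power_ge _ Tz zt2; lra.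
  rewrite CE; have := HBf _ bz; have := HBf _ b0; rewrite -/f0 !ler_norml => /andP[? ?]
    /andP[? ?]; lra.
(* The upper barrier is the mirror image, with negative [theta]. *)
pose u : S -> R := barrier (f0 + eps) (- 2 * (- (C / 2))) c (- (C / 2)) kappa (1 + c).
have uE z : u z = f0 + eps + C * (power z - gaussian kappa (1 + c) z / 2).
  by rewrite /u /barrier -/(power z); field.
have uge z : Theta z -> f0 + eps + C * (power z / 2) <= u z.
  by move=> Tz; rewrite uE lerD2l ler_pM2l //; have := gaussian_le Tz; lra.
apply: (@le_trans _ _ (u xi)%:E); last first.
  by rewrite lee_fin uE lerD2l ler_pM2l // gerBl divr_ge0 // expR_ge0.
apply: (@upper_perron_le f (EFin \o u)).
  apply: (classical_superparabolic n0 p1 (@open_petrovsky R n A)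
    (radial2_barrier _ _ _ _ _ _ (@petrovsky_time R n A))).
    by move=> z Tz; apply: F1_neq0 => //; rewrite oppr_eq0 gt_eqF // divr_gt0.
  move=> z Tz; rewrite subr0; have [q q0 E] := critical_equation (- (C / 2)) Tz.
  by rewrite -subr_le0 E mulNr oppr_le0 mulr_ge0 // ltW // divr_gt0.
move=> zeta bz; have [zt|zt] := ltP (- t1) zeta.2.
  apply: (@filterE _ (nbhs zeta) (nbhs_filter zeta)) => z Tz; rewrite lee_fin; apply:
    le_trans (uge z Tz).
  have : 0 <= C * (power z / 2) by rewrite mulr_ge0 ?ltW // divr_gt0 // expR_gt0.
  have := near0 _ bz zt; rewrite ltr_norml => /andP[]; lra.
apply: (@filterS _ (nbhs zeta) (nbhs_filter zeta) _ _ _ (near_early _ zt)) => z zt2 Tz.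
rewrite lee_fin; apply: le_trans (uge z Tz).
have : C * wmin <= C * (power z / 2).
  by rewrite ler_pM2l //; have := power_ge _ Tz zt2; lra.
rewrite CE; have := HBf _ bz; have := HBf _ b0; rewrite -/f0 !ler_norml => /andP[? ?]
  /andP[? ?]; lra.
Qed.

Lemma petrovsky_regular : regular_point p Theta (0, 0).
Proof.
split; first exact: origin_boundary.
move=> f cf V nV.
have [e /= e0 HV] : exists2 e : R, 0 < e & forall r, `|f (0, 0) - r| < e -> V r%:E.
  have /nbhs_normP[e e0 HV] : nbhs (f (0, 0)) (fun r => V r%:E) by exact: nV.
  by exists e.
have e2 : 0 < e / 2 by rewrite divr_gt0.
have [C C0 bnd] := perron_bounds cf e2.
have [s0 s00 Hs] := expR_ln_tau_small c0 (divr_gt0 e2 C0).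
have nt : nbhs ((0, 0) : S) [set z | - s0 < z.2].
  have cz : {for ((0, 0) : S), continuous (fun z : S => z.2)} by exact: cvg_snd.
  by apply: (cvgr_gt _ cz); rewrite /= oppr_lt0.
apply: (@filterS _ (nbhs ((0, 0) : S)) (nbhs_filter _) _ _ _ nt) => z zs Tz /=.
have power_small : C * power z < e / 2.
  rewrite mulrC -ltr_pdivlMr //; apply: Hs.
    by have /andP[_] := petrovsky_time Tz; rewrite oppr_gt0.
  by rewrite ltrNl.
have /andP[] := bnd z Tz.
case: (upper_perron p Theta f z) => [r| |//]; last by rewrite leye_eq.
rewrite !lee_fin => h1 h2; apply: HV; rewrite ltr_norml; apply/andP; split; lra.
Qed.

End Critical.

(** * Irregularity for [A > 4 * (p - 1)] *)

Lemma petrovsky_irregular : 4 * (p - 1) < A -> ~ regular_point p Theta (0, 0).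
Proof.
move=> Abig [_ reg].
have K0 : 0 < p - 1 by rewrite subr_gt0.
have N0 : 0 < n%:R + p - 2.
  have h1 : (1 : R) <= n%:R by rewrite ler1n.
  by move: p1 h1; lra.
pose kappa := (A^-1 + (4 * (p - 1))^-1) / 2.
have iA : A^-1 < (4 * (p - 1))^-1 by rewrite ltf_pV2 ?posrE // mulr_gt0.
have iA0 : 0 < A^-1 by rewrite invr_gt0.
have kA : A^-1 < kappa by rewrite /kappa; lra.
have kK : kappa < (4 * (p - 1))^-1 by rewrite /kappa; lra.
have kappa0 : 0 < kappa by apply: lt_trans kA.
clearbody kappa.
have kK1 : 0 < 1 - 4 * (p - 1) * kappa.
  have h4 : 0 < 4 * (p - 1) by rewrite mulr_gt0.
  by rewrite subr_gt0 mulrC -ltr_pdivlMr // div1r.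
pose q := kappa * A.
have q1 : 1 < q by rewrite -ltr_pdivrMr // div1r.
have q0 : 0 < q by apply: lt_trans q1.
(* With [y2 = |x|^2 / s], the subsolution inequality will follow from
   [exp(kappa y2) (D1 - D2 y2) <= C c]; [D2 > 0] because [kappa] is below [1 / (4 (p - 1))]. *)
pose D1 := 2 * (n%:R + p - 2) * kappa + q.
pose D2 := kappa * (1 - 4 * (p - 1) * kappa).
have D10 : 0 < D1 by rewrite addr_gt0 // !mulr_gt0.
have D20 : 0 < D2 by rewrite mulr_gt0.
pose c := q - 1.
have c0 : 0 < c by rewrite subr_gt0.
(* The first summand covers [y2 <= D1 / D2], beyond which [D1 - D2 y2] is nonpositive; the added 1
   gives [C >= 1], used on the axis. *)
pose C := D1 * expR (kappa * (D1 / D2)) / c + 1.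
have C1 : 1 <= C by rewrite lerDr ltW // divr_gt0 // mulr_gt0 // expR_gt0.
have Cc : D1 * expR (kappa * (D1 / D2)) <= C * c.
  by rewrite /C [leRHS]mulrDl mul1r divfK ?gt_eqF // lerDl ltW.
pose power (xi : S) := expR (- c * ln (tau xi)).
pose v : S -> R := barrier 1 C c (- 1) kappa q.
have vE z : v z = 1 + C * power z - gaussian kappa q z by rewrite /v /barrier -/(power
  z); ring.
(* The term [3 * - z.2] makes [v < f] strict: on the lateral boundary it is positive, and on the
   bottom, where [s = 1 / 3], it equals the constant 1 of [v]. *)
pose f (z : S) := if z.2 < 0 then C * power z + 3 * - z.2 else 0.
have cbar (O : set S) : (forall xi, O xi -> -1 < xi.2 < 0) -> forall z, O z -> {for z,
  continuous v}.
  by move=> HO z; exact: radial2_continuous (radial2_barrier _ _ _ _ _ _ HO).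
pose O1 : set S := [set z | -1 < z.2 < 0].
have oO1 : open O1.
  rewrite (_ : O1 = snd @^-1` `](-1), 0[%classic).
    by apply: open_comp; [move=> z _; exact: cvg_snd|exact: itv_open].
  by apply/seteqP; split=> z /=; rewrite in_itv.
have cf : {within boundary Theta, continuous f}.
  apply: continuous_in_subspaceT => z /set_mem /(boundary_petrovsky A0)[/andP[z1 z2] _ _].
  have cz : {for z, continuous (fun z : S => z.2)} by exact: cvg_snd.
  move: z2; rewrite le_eqVlt => /orP[/eqP zE|zneg].
    have fz : f z = 0 by rewrite /f zE ltxx.
    apply/cvgrPdist_lt => e e0.
    have Ce : 0 < e / 2 / C by rewrite !divr_gt0 //; apply: lt_le_trans C1.
    have [s0 s00 Hs] := expR_ln_tau_small c0 Ce.
    have s1 : 0 < Num.min s0 (e / 6) by rewrite lt_min s00 divr_gt0.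
    have nz : nbhs z [set z' : S | - Num.min s0 (e / 6) < z'.2].
      by apply: (cvgr_gt _ cz); rewrite /= zE oppr_lt0.
    apply: (@filterS _ (nbhs z) (nbhs_filter _) _ _ _ nz) => z' /=.
    rewrite ltrNl lt_min => /andP[zs ze]; rewrite fz sub0r normrN /f; case: ifPn =>
      zneg; last by rewrite normr0.
    have sp : 0 < - z'.2 by rewrite oppr_gt0.
    have := Hs _ sp zs; rewrite ltr_pdivlMr; last exact: lt_le_trans C1.
    have p0 : 0 < power z' by exact: expR_gt0.
    have Cp : 0 < C * power z' by rewrite mulr_gt0 //; exact: lt_le_trans C1.
    rewrite -/(tau z') -/(power z') => h; rewrite ger0_norm; first by lra.
    by apply: addr_ge0; [exact: ltW|apply: mulr_ge0; [|exact: ltW]].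
  have Oz : O1 z by rewrite /O1 /= zneg andbT; lra.
  have rg := radial2D (@radial2_barrier R n O1 0 C c 0 kappa q (fun _ h => h))
                      (radial2Z 3 (radial2N (radial2_time O1 0))).
  have cg := radial2_continuous rg Oz.
  have fE z' : O1 z' -> barrier 0 C c 0 kappa q z' + 3 * - z'.2 = f z'.
    by move=> /andP[_ h]; rewrite /f h /barrier mul0r addr0 add0r.
  rewrite /prop_for /continuous_at -(fE z Oz); apply: cvg_trans cg; apply: near_eq_cvg.
  have nO : nbhs z O1 by exact: open_nbhs_nbhs.
  by apply: (@filterS _ (nbhs z) (nbhs_filter _) _ _ _ nO) => z' /fE.
have vPf xi : Theta xi -> ((v xi)%:E <= upper_perron p Theta f xi)%E.
  apply: (upper_perron_ge (radial2_barrier _ _ _ _ _ _ (@petrovsky_time R n A))).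
  - move=> z /petrovsky_time/andP[_ z0]; apply: mulf_neq0; first by rewrite oppr_eq0
    oner_eq0.
    apply: mulf_neq0; first by rewrite gt_eqF // expR_gt0.
    by rewrite mulf_neq0 ?gt_eqF // invr_gt0 oppr_gt0.
  - move=> z Tz; have [l0 t1] := petrovsky_tau A0 Tz.
    have /andP[_ z0] := petrovsky_time Tz.
    set E := gaussian kappa q z; set s := - z.2.
    have s0 : 0 < s by rewrite oppr_gt0.
    have tp : 0 < tau z by apply: lt_trans t1.
    pose y2 := sqnorm z.1 / s.
    have y20 : 0 <= y2 by rewrite divr_ge0 ?sqnorm_ge0 // ltW.
    (* As [q = c + 1], the common factor [power / tau] splits off from both terms of the barrier. *)
    have EE : E = expR (kappa * y2) * (power z / tau z).
      rewrite /E /gaussian /power (_ : _ / _ - _ = kappa * y2 + (- c * ln (tau z) - ln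
        (tau z))).
        by rewrite !expRD expRN lnK.
      by rewrite /y2 /c /s; ring.
    have P0 : 0 < power z / tau z by rewrite divr_gt0 // expR_gt0.
    have key : expR (kappa * y2) * (2 * (n%:R + p - 2) * kappa + q / tau z - D2 * y2)
      <= C * c.
      have qt : q / tau z <= q by rewrite ler_pdivrMr // ler_pMr // ltW.
      apply: le_trans Cc; have [big|small] := leP D1 (D2 * y2).
        apply: (@le_trans _ _ 0); last by rewrite mulr_ge0 ?expR_ge0 // ltW.
        by rewrite mulr_ge0_le0 ?expR_ge0 // subr_le0 (le_trans _ big) // /D1 lerD2l.
      have yD : y2 <= D1 / D2 by rewrite ler_pdivlMr // mulrC ltW.
      apply: (@le_trans _ _ (expR (kappa * y2) * D1)).
        rewrite ler_wpM2l ?expR_ge0 //.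
        have : 0 <= D2 * y2 by rewrite mulr_ge0 // ltW.
        by rewrite /D1; move: qt; lra.
      by rewrite mulrC ler_wpM2l ?(ltW D10) // ler_expR ler_wpM2l // ltW.
    rewrite -subr_ge0.
    have -> : 2 * (n%:R + p - 2) * (- 1 * (E * (kappa / s)))
        + 4 * (p - 1) * sqnorm z.1 * (- 1 * (E * (kappa / s) ^+ 2))
        - (C * (expR (- c * ln (tau z)) * (- c / (s * tau z)))
           + - 1 * (E * (kappa * sqnorm z.1 / z.2 ^+ 2 - q / (s * tau z))))
      = power z / tau z / s * (C * c - expR (kappa * y2) * (2 * (n%:R + p - 2) * kappa
        + q / tau z - D2 * y2)).
      rewrite EE -/(power z) /D2 /y2 /s; field.
      by rewrite (ltr0_neq0 z0) (lt0r_neq0 tp).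
    by rewrite mulr_ge0 ?subr_ge0 // ltW // divr_gt0.
  move=> zeta bz zneg.
  have [/andP[z13 _] _ nT] := boundary_petrovsky A0 bz.
  have Oz : O1 zeta by rewrite /O1 /= zneg andbT; lra.
  have E0 : 0 < gaussian kappa q zeta by exact: expR_gt0.
  have vf : v zeta < f zeta.
    rewrite vE /f zneg; move: z13; rewrite le_eqVlt => /orP[/eqP <-|z13]; first by lra.
    (* A lateral boundary point is outside the domain, so [|x|^2 >= A s ln tau]; with
       [q = kappa * A] the exponent is nonnegative. *)
    have E1 : 1 <= gaussian kappa q zeta.
      rewrite -expR0 ler_expR subr_ge0 ler_pdivlMr ?oppr_gt0 //.
      have : A * - zeta.2 * ln (tau zeta) <= sqnorm zeta.1.
        by rewrite leNgt; apply/negP => h; apply: nT; apply/petrovskyP; rewrite z13 zneg.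
      by rewrite /q -(ler_pM2l kappa0); lra.
    by move: zneg; lra.
  exists ((v zeta + f zeta) / 2); first by lra.
  have cv := cbar O1 (fun _ h => h) zeta Oz.
  have va : v zeta < (v zeta + f zeta) / 2 by lra.
  by apply: (@filterS _ (nbhs zeta) (nbhs_filter _) _ _ _ (cvgr_lt _ cv _ va)) => z /ltW.
have f00 : f (0, 0) = 0 by rewrite /f /= ltxx.
have nV : nbhs (f (0, 0))%:E [set x : \bar R | (x < (1 / 2)%:E)%E].
  by rewrite f00; apply: open_ereal_lt'; rewrite lte_fin divr_gt0.
have [r r0 Hr] := nbhs_cube (reg f cf _ nV).
have [t /andP[tr t0] Tt] := petrovsky_axis (n := n) A0 r0.
have ct : cube ((0, 0) : S) r (0, t).
  apply/cubeP; split=> [i|] /=; rewrite ?subrr ?normr0 //.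
  by rewrite subr0 ler0_norm ?ltW // ltrNl.
have /= := Hr _ ct Tt; apply/negP; rewrite -leNgt; apply: le_trans (vPf _ Tt).
have [l0 t1] := petrovsky_tau A0 Tt.
have tp : 0 < tau ((0, t) : S) by apply: lt_trans t1.
(* On the axis the Gaussian is [tau^(-q) <= tau^(-c)], so [v >= 1] there, arbitrarily close to the
   origin where [f] is 0. *)
have Eax : gaussian kappa q ((0, t) : S) <= power (0, t).
  rewrite ler_expR /=; have /eqP -> : sqnorm (0 : 'rV[R]_n) == 0 by rewrite sqnorm_eq0.
  by rewrite mulr0 mul0r /c; move: l0; lra.
have P0 : 0 < power (0, t) by exact: expR_gt0.
have : power (0, t) <= C * power (0, t) by rewrite ler_peMl // ltW.
by rewrite lee_fin vE; lra.
Qed.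

End Regularity.

Theorem theorem1p2 (R : realType) (n : nat) (p A : R)
    (hn : (1 <= n)%N) (hp : 1 < p) (hA : 0 < A) :
  regular_point p (petrovsky_domain n A) (0, 0) <-> A <= 4 * (p - 1).
Proof.
split=> [reg|]; last exact: petrovsky_regular.
by rewrite leNgt; apply/negP => /(petrovsky_irregular hn hp hA).
Qed.
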